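(* For any constant $p<1$ and any constant $\delta>0$ there is a randomized encoding scheme that, given access to a defective memory of length $n$ containing $pn$ defective cells, uses $O(\log^3 n)$ clean memory cells and can store $(1-p-\delta)n$ bits. The encoding and decoding times for the scheme are polynomial in $n$ and $1/\delta$.
   Context: A memory with $n$ binary cells has $pn$ defects if there are a set $S\subset[n]$ with $|S|=pn$ and fixed values $a\in\{0,1\}^S$ such that each cell $i\in S$ always holds the value $a_i$ and cannot be changed. The writer knows $S$ and $a$; the reader sees only the content of the memory and cannot distinguish defective from proper cells. In addition to the $n$ cells there are a number $d=O(\log^3 n)$ of clean (undamaged) cells whose identity is known to both the writer and the reader. A randomized encoding scheme storing $k$ bits with $d$ clean cells consists of a randomized encoder and a deterministic decoder $\mathrm{Dec}:\{0,1\}^n\times\{0,1\}^d\to\{0,1\}^k$. For every defect pattern $(S,a)$ with $|S|=pn$ and every message $y\in\{0,1\}^k$, the encoder, given $(S,a)$ and $y$, produces a memory content $x\in\{0,1\}^n$ with $x_i=a_i$ for all $i\in S$ and a content $r\in\{0,1\}^d$ for the clean cells such that $\mathrm{Dec}(x,r)=y$. The encoder may draw fresh randomness and retry until it finds a valid output, so encoding time is understood as expected time over the encoder's randomness. The decoder is not given $(S,a)$. The statement is asymptotic: $p\geq 0$ and $\delta$ are fixed with $p+\delta<1$ and $n$ is sufficiently large; rounding of $pn$ and $(1-p-\delta)n$ to integers is ignored. *)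

(* Defs.v *)
From mathcomp Require Import all_boot all_order all_algebra.
From mathcomp Require Import all_classical all_reals all_analysis.

Set Implicit Arguments.
Unset Strict Implicit.
Unset Printing Implicit Defensive.

Import Order.TTheory GRing.Theory Num.Theory.

Local Open Scope ring_scope.

(** Model of computation: Jones' WHILE language over binary trees (N. D. Jones,
    "Computability and Complexity from a Programming Perspective", 1997), in
    three-address form and extended with a fair coin flip.  Every instruction
    works on a fixed number of registers holding pointers to immutable trees
    (equivalently, it runs on a pointer machine) and costs one time unit; there
    is no tree comparison or arithmetic.  Running times in this model agree with
    multitape Turing machine times up to a polynomial. *)

Inductive tree : Type := Leaf | Node of tree & tree.

Definition is_node (t : tree) : bool := if t is Node _ _ then true else false.
Definition left_tree (t : tree) : tree := if t is Node l _ then l else Leaf.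
Definition right_tree (t : tree) : tree := if t is Node _ r then r else Leaf.

Definition tree_of_bit (b : bool) : tree := if b then Node Leaf Leaf else Leaf.

Definition tree_of_seq (T : Type) (f : T -> tree) (s : seq T) : tree :=
  foldr (fun x t => Node (f x) t) Leaf s.

Definition tree_of_bits (s : seq bool) : tree := tree_of_seq tree_of_bit s.

Definition tree_of_unary (m : nat) : tree := tree_of_bits (nseq m true).

Definition var := nat.

Inductive cmd : Type :=
  | CLeaf of var                (* x := Leaf *)
  | CCopy of var & var          (* x := y *)
  | CNode of var & var & var    (* x := Node y z *)
  | CLeft of var & var          (* x := left subtree of y *)
  | CRight of var & var         (* x := right subtree of y *)
  | CFlip of var                (* x := a fresh random bit *)
  | CSeq of cmd & cmd
  | CIf of var & cmd & cmd      (* tests whether x holds a Node *)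
  | CWhile of var & cmd.        (* loops as long as x holds a Node *)

Fixpoint deterministic (c : cmd) : bool :=
  match c with
  | CFlip _ => false
  | CSeq c1 c2 | CIf _ c1 c2 => deterministic c1 && deterministic c2
  | CWhile _ c1 => deterministic c1
  | _ => true
  end.

Definition store := var -> tree.

Definition set_var (s : store) (x : var) (t : tree) : store :=
  fun y => if y == x then t else s y.

(** A configuration is the stack of commands still to be executed, together
    with the current store. *)
Definition config := (seq cmd * store)%type.

Definition halted (g : config) : bool := nilp g.1.

(** One unit of time.  A fresh bit [b] is supplied at every step, but only
    [CFlip] looks at it. *)
Definition step (b : bool) (g : config) : config :=
  let: (k, s) := g in
  match k with
  | [::] => g
  | c :: k' =>
    match c with
    | CLeaf x => (k', set_var s x Leaf)
    | CCopy x y => (k', set_var s x (s y))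
    | CNode x y z => (k', set_var s x (Node (s y) (s z)))
    | CLeft x y => (k', set_var s x (left_tree (s y)))
    | CRight x y => (k', set_var s x (right_tree (s y)))
    | CFlip x => (k', set_var s x (tree_of_bit b))
    | CSeq c1 c2 => (c1 :: c2 :: k', s)
    | CIf x c1 c2 => ((if is_node (s x) then c1 else c2) :: k', s)
    | CWhile x c1 => ((if is_node (s x) then c1 :: c :: k' else k'), s)
    end
  end.

(** Register 0 holds the input at the start and the output at the end. *)
Definition init (c : cmd) (input : tree) : config :=
  ([:: c], set_var (fun=> Leaf) 0%N input).

Definition run (c : cmd) (input : tree) (w : seq bool) : config :=
  foldl (fun g b => step b g) (init c input) w.

Definition output (g : config) : tree := g.2 0%N.

(** With coins [w], the running time is exactly [size w]. *)
Definition halts_exactly (c : cmd) (input : tree) (w : seq bool) : bool :=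
  halted (run c input w) &&
  [forall i : 'I_(size w), ~~ halted (run c input (take i w))].

(** The event "the running time equals [t]" only depends on the first [t]
    coins, so its probability is computed over uniform strings of [t] coins. *)
Definition time_prob (R : realType) (c : cmd) (input : tree) (t : nat) : R :=
  #|[set w : t.-tuple bool | halts_exactly c input w]|%:R / 2 ^+ t.

Definition halting_prob (R : realType) (c : cmd) (input : tree) : \bar R :=
  (\sum_(0 <= t <oo) (time_prob R c input t)%:E)%E.

(** This is the expectation of the running time when [halting_prob] is 1. *)
Definition expected_time (R : realType) (c : cmd) (input : tree) : \bar R :=
  (\sum_(0 <= t <oo) (t%:R * time_prob R c input t)%:E)%E.

Definition expected_time_le (R : realType) (c : cmd) (input : tree) (T : R) :
    Prop :=
  halting_prob R c input = 1%E /\ (expected_time R c input <= T%:E)%E.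

(** For a deterministic command the coins are irrelevant. *)
Definition computes_within (R : realType) (c : cmd) (input out : tree) (T : R) :
    Prop :=
  exists t : nat, [/\ t%:R <= T,
    halts_exactly c input (nseq t false) &
    output (run c input (nseq t false)) = out].

(** A defect pattern is given by [S] and [a], where only the values of [a] on
    [S] matter: it is encoded as the list of the states of the [n] cells,
    either proper or stuck at a given bit. *)
Definition cell_state (n : nat) (S : {set 'I_n}) (a : 'I_n -> bool) (i : 'I_n) :
    option bool :=
  if i \in S then Some (a i) else None.

Definition tree_of_cell (c : option bool) : tree :=
  if c is Some b then Node (tree_of_bit b) Leaf else Leaf.

Definition tree_of_defects (n : nat) (S : {set 'I_n}) (a : 'I_n -> bool) : tree :=
  tree_of_seq tree_of_cell [seq cell_state S a i | i <- enum 'I_n].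

Definition encoder_input (n k : nat) (S : {set 'I_n}) (a : 'I_n -> bool)
    (y : k.-tuple bool) : tree :=
  Node (tree_of_defects S a) (tree_of_bits y).

Definition memory_content (n d : nat) (x : n.-tuple bool) (r : d.-tuple bool) :
    tree :=
  Node (tree_of_bits x) (tree_of_bits r).

(** The message length [k] is a public parameter of the scheme and is passed in
    unary: when [p] and [delta] are arbitrary reals, the integer part of
    [(1 - p - delta) * n] need not be computable from [n].  The encoder can
    read [n], [k] and the number of defects off its input. *)
Definition decoder_input (n k d : nat) (x : n.-tuple bool) (r : d.-tuple bool) :
    tree :=
  Node (memory_content x r) (tree_of_unary k).

(** [enc] and [dec] store [k] bits in [n] cells, [s] of them defective, with the
    help of [d] clean cells; [T] bounds the expected encoding time and the
    decoding time. *)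
Definition encoding_scheme (R : realType) (n s k d : nat) (enc dec : cmd) (T : R) :
    Prop :=
  exists Dec : n.-tuple bool -> d.-tuple bool -> k.-tuple bool,
    [/\ deterministic dec,
        forall (x : n.-tuple bool) (r : d.-tuple bool),
          computes_within dec (decoder_input k x r) (tree_of_bits (Dec x r)) T &
        forall (S : {set 'I_n}) (a : 'I_n -> bool) (y : k.-tuple bool),
          #|S| = s ->
          expected_time_le enc (encoder_input S a y) T /\
          (forall w : seq bool, halts_exactly enc (encoder_input S a y) w ->
             exists (x : n.-tuple bool) (r : d.-tuple bool),
               [/\ output (run enc (encoder_input S a y) w) = memory_content x r,
                   forall i : 'I_n, i \in S -> tnth x i = a i &
                   Dec x r = y])].

(* Main.v *)
(** Cut the [n] cells into [b] layers of [M = 2 ^ m] cells, with [b] of order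
    [log n], and rotate every layer by a random amount.  By a Chernoff bound, for
    all the positions [v < M] simultaneously, the number of free cells at
    position [v] of the rotated layers is close to its mean, hence exceeds by
    far the number [K], roughly [k / M], of message bits to be stored there.
    One random binary matrix with [b] columns, used at all positions, then has
    rank [K] on the free cells of every position.  The rotations and the matrix
    take [b * (m + b)], hence [O(log^2 n)], random bits, which are written in the
    clean cells.

    The decoder is linear in the memory content once these bits are fixed, so
    the encoder draws them, computes the images of the unit vectors of the free
    cells, and solves for the message by Gaussian elimination; it retries when
    this fails, which happens with probability at most 1/2.  A failure is
    witnessed by a vector [u <> 0] and a position [v] such that [u] is orthogonal
    to all the matrix columns of the layers that are free at [v].  The expected
    number of such witnesses, restricted to the positions with many free cells,
    is a sum of products over the independent layers.

    The constant hidden in [b] depends on [delta]; it is an input of fixed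
    polynomial-time functions, which makes the degree of the time bound
    independent of [p] and [delta]. *)

Require Import Defs.
From mathcomp Require Import all_boot all_order all_algebra.
From mathcomp Require Import all_classical all_reals all_analysis.
From mathcomp Require Import zify ring lra.

Set Implicit Arguments.
Unset Strict Implicit.
Unset Printing Implicit Defensive.

Import Order.TTheory GRing.Theory Num.Theory.

(** * Big-step semantics of coin-free commands *)

(** A uniform rotation gives every position the same mean number of free cells, the total divided by
    [M], whatever the defect pattern. The Chernoff failure must beat a union over [2 ^ m] positions,
    so each position has to meet at least [C.+1 * m] layers with [C] about [60 / delta ^ 2]; [M] is
    doubled as long as this permits. Which columns count at a position depends on the rotations.
    Instead of conditioning on them, a layer gets the factor 2 if it is free and orthogonal to [u],
    0 if free and not orthogonal, 1 if not free. Its mean is always 1, so the expected total weight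
    of the vectors [u] at a position is at most [2 ^ K], while a witness at a position with more
    than [theta] free cells weighs more than [2 ^ theta]. With [theta = K + m + 2] both error terms
    are at most [2 ^- (m + 2)] per position, in total 1/2. On the machine, one step can double a
    tree by sharing, so sizes are bounded separately from times. Correctness of every halting run is
    read off the halving of the failure probability: a wrong finite run would keep a fixed positive
    probability. *)

Inductive exec : cmd -> store -> nat -> store -> Prop :=
  | ExecLeaf s x : exec (CLeaf x) s 1 (set_var s x Leaf)
  | ExecCopy s x y : exec (CCopy x y) s 1 (set_var s x (s y))
  | ExecNode s x y z : exec (CNode x y z) s 1 (set_var s x (Node (s y) (s z)))
  | ExecLeft s x y : exec (CLeft x y) s 1 (set_var s x (left_tree (s y)))
  | ExecRight s x y : exec (CRight x y) s 1 (set_var s x (right_tree (s y)))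
  | ExecSeq c1 c2 s1 t1 s2 t2 s3 :
      exec c1 s1 t1 s2 -> exec c2 s2 t2 s3 -> exec (CSeq c1 c2) s1 (t1 + t2).+1 s3
  | ExecIf x c1 c2 s t s' :
      exec (if is_node (s x) then c1 else c2) s t s' -> exec (CIf x c1 c2) s t.+1 s'
  | ExecWhile0 x c s : is_node (s x) = false -> exec (CWhile x c) s 1 s
  | ExecWhileS x c s1 t1 s2 t2 s3 :
      is_node (s1 x) -> exec c s1 t1 s2 -> exec (CWhile x c) s2 t2 s3 ->
      exec (CWhile x c) s1 (t1 + t2).+1 s3.

Definition run_from (g : config) (w : seq bool) : config :=
  foldl (fun g b => step b g) g w.

Lemma run_from_cons g b w : run_from g (b :: w) = run_from (step b g) w.
Proof. by []. Qed.

Lemma run_from_cat g w1 w2 :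
  run_from g (w1 ++ w2) = run_from (run_from g w1) w2.
Proof. by rewrite /run_from foldl_cat. Qed.

Lemma run_from_halted g w : halted g -> run_from g w = g.
Proof.
case: g => [[|c k] s] // _; elim: w => [|b w IHw] //=; exact: IHw.
Qed.

(** Coin-free steps ignore the supplied bits and never inspect the stack [k] below them. This is
    what lets deterministic blocks be used inside a randomized program. *)
Lemma exec_run c s t s' : exec c s t s' ->
  forall k w, size w = t -> run_from (c :: k, s) w = (k, s').
Proof.
have split_w : forall (w : seq bool) t1 t2, size w = (t1 + t2).+1 ->
    exists b w1 w2, [/\ w = b :: w1 ++ w2, size w1 = t1 & size w2 = t2].
  move=> [|b w] // t1 t2 [sz_w]; exists b, (take t1 w), (drop t1 w).
  by rewrite cat_take_drop size_drop sz_w addKn size_takel ?sz_w ?leq_addr.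
elim=> {c s t s'}.
- by move=> s x k [|b []].
- by move=> s x y k [|b []].
- by move=> s x y z k [|b []].
- by move=> s x y k [|b []].
- by move=> s x y k [|b []].
- move=> c1 c2 s1 t1 s2 t2 s3 _ IH1 _ IH2 k w /split_w [b [w1 [w2 [-> sz1 sz2]]]].
  by rewrite run_from_cons /= run_from_cat IH1 // IH2.
- by move=> x c1 c2 s t s' _ IH k [|b w] // [sz_w]; rewrite run_from_cons /= IH.
- by move=> x c s Es k [|b []] //= _; rewrite Es.
- move=> x c s1 t1 s2 t2 s3 Es _ IH1 _ IH2 k w /split_w [b [w1 [w2 [-> sz1 sz2]]]].
  by rewrite run_from_cons /= Es run_from_cat IH1 // IH2.
Qed.

(** Renaming registers upwards serves as a subroutine call: the shifted code touches no register
    below [o], where the caller keeps its data. *)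
Fixpoint shift_cmd (o : nat) (c : cmd) : cmd :=
  match c with
  | CLeaf x => CLeaf (o + x)
  | CCopy x y => CCopy (o + x) (o + y)
  | CNode x y z => CNode (o + x) (o + y) (o + z)
  | CLeft x y => CLeft (o + x) (o + y)
  | CRight x y => CRight (o + x) (o + y)
  | CFlip x => CFlip (o + x)
  | CSeq c1 c2 => CSeq (shift_cmd o c1) (shift_cmd o c2)
  | CIf x c1 c2 => CIf (o + x) (shift_cmd o c1) (shift_cmd o c2)
  | CWhile x c1 => CWhile (o + x) (shift_cmd o c1)
  end.

Lemma shift_deterministic o c : deterministic (shift_cmd o c) = deterministic c.
Proof. by elim: c => //= [c1 -> c2 ->|_ c1 -> c2 ->]. Qed.

Definition glue_store (o : nat) (s s1 : store) : store :=
  fun x => if (x < o)%N then s x else s1 (x - o)%N.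

Lemma exec_shift o c s1 t s1' : exec c s1 t s1' ->
  forall s, exec (shift_cmd o c) (glue_store o s s1) t (glue_store o s s1').
Proof.
have glue_var s s2 x : glue_store o s s2 (o + x)%N = s2 x.
  by rewrite /glue_store ltnNge leq_addr /= addKn.
have glue_set s s2 x u :
    glue_store o s (set_var s2 x u) = set_var (glue_store o s s2) (o + x)%N u.
  apply: funext => y; rewrite /glue_store /set_var.
  case: ltnP => yo; first by case: eqP => //; lia.
  by congr (if _ then _ else _); apply/eqP/eqP; lia.
elim=> {c s1 t s1'} /=.
- by move=> s1 x s; rewrite glue_set; constructor.
- by move=> s1 x y s; rewrite glue_set -(glue_var s s1 y); constructor.
- move=> s1 x y z s; rewrite glue_set -(glue_var s s1 y) -(glue_var s s1 z).
  by constructor.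
- by move=> s1 x y s; rewrite glue_set -(glue_var s s1 y); constructor.
- by move=> s1 x y s; rewrite glue_set -(glue_var s s1 y); constructor.
- by move=> c1 c2 s1 t1 s2 t2 s3 _ IH1 _ IH2 s; apply: ExecSeq (IH1 s) (IH2 s).
- move=> x c1 c2 s1 t s1' _ IH s; apply: ExecIf; rewrite glue_var.
  by move: (IH s); case: ifP.
- by move=> x c s1 Es s; apply: ExecWhile0; rewrite glue_var.
- move=> x c s1 t1 s2 t2 s3 Es _ IH1 _ IH2 s.
  by apply: ExecWhileS (IH1 s) (IH2 s); rewrite glue_var.
Qed.

(** * Polynomial-time computable functions *)

Section PolyTime.

Local Open Scope nat_scope.

(** Weights exceed 1, the range where plain powers [X ^ e] absorb constants and sums, and the weight
    of an encoded pair is exactly the sum of the two weights. *)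
Fixpoint weight (t : tree) : nat :=
  if t is Node l r then weight l + weight r else 3.

Lemma weight_ge3 t : 3 <= weight t.
Proof. by elim: t => //= l IHl r IHr; lia. Qed.

Definition poly_bounded (f : nat -> nat) := exists e, forall X, 1 < X -> f X <= X ^ e.

Lemma poly_bounded_const c : poly_bounded (fun=> c).
Proof.
by exists c => X X1; apply: ltnW (ltn_expl _ X1).
Qed.

Lemma poly_bounded_id : poly_bounded id.
Proof. by exists 1 => X _; rewrite expn1. Qed.

Lemma poly_bounded_add f g :
  poly_bounded f -> poly_bounded g -> poly_bounded (fun X => f X + g X).
Proof.
move=> [a fa] [b gb]; exists (a + b).+1 => X X1.
have Xp e : 0 < X ^ e by rewrite expn_gt0 (ltnW X1).
apply: (@leq_trans (X ^ (a + b) + X ^ (a + b))); last first.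
  by rewrite expnS addnn -muln2 mulnC leq_mul2r X1 orbT.
apply: leq_add; first by apply: leq_trans (fa X X1) _; rewrite expnD leq_pmulr.
by apply: leq_trans (gb X X1) _; rewrite expnD leq_pmull.
Qed.

Lemma poly_bounded_mul f g :
  poly_bounded f -> poly_bounded g -> poly_bounded (fun X => f X * g X).
Proof.
move=> [a fa] [b gb]; exists (a + b) => X X1.
by rewrite expnD leq_mul ?fa ?gb.
Qed.

Lemma poly_bounded_exp f e : poly_bounded f -> poly_bounded (fun X => f X ^ e).
Proof.
move=> [a fa]; exists (a * e) => X X1; rewrite expnM.
by case: e => // e; rewrite leq_exp2r // fa.
Qed.

Lemma poly_bounded_succ f : poly_bounded f -> poly_bounded (fun X => (f X).+1).
Proof.
move=> pf; have [e He] := poly_bounded_add pf (poly_bounded_const 1).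
by exists e => X X1; rewrite -addn1 He.
Qed.

End PolyTime.

Ltac poly_bound :=
  repeat first [ apply: poly_bounded_const | apply: poly_bounded_id
    | apply: poly_bounded_add | apply: poly_bounded_mul
    | apply: poly_bounded_succ | apply: poly_bounded_exp ].

Class encoding (A : Type) := encode : A -> tree.
#[global] Hint Mode encoding ! : typeclass_instances.

#[global] Instance encoding_bool : encoding bool := tree_of_bit.
#[global] Instance encoding_nat : encoding nat := tree_of_unary.
#[global] Instance encoding_seq A (eA : encoding A) : encoding (seq A) :=
  tree_of_seq eA.
#[global] Instance encoding_prod A B (eA : encoding A) (eB : encoding B) :
  encoding (A * B) := fun z => Node (eA z.1) (eB z.2).
#[global] Instance encoding_option A (eA : encoding A) : encoding (option A) :=
  fun o => if o is Some a then Node (eA a) Leaf else Leaf.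

Definition wt A (eA : encoding A) (a : A) : nat := weight (encode a).
Arguments wt {A eA} a.

(** The output weight is bounded separately because one [CNode] can double a tree in unit time. Only
    register 0 is constrained at the start, so the command tolerates garbage elsewhere and calls can
    be chained without cleaning up. *)
Definition polytime A B (eA : encoding A) (eB : encoding B) (f : A -> B) : Prop :=
  exists c e, deterministic c /\ forall s a, s 0%N = encode a ->
    exists t s', [/\ exec c s t s', s' 0%N = encode (f a),
      (t <= wt a ^ e)%N & (wt (f a) <= wt a ^ e)%N].
Arguments polytime {A B eA eB} f.

(** * Closure of polynomial time under composition, pairing, tests and folds *)

Section Combinators.

Local Open Scope nat_scope.

Lemma wt_ge3 A {eA : encoding A} (a : A) : 3 <= wt a.
Proof. exact: weight_ge3. Qed.

Lemma wt_gt1 A {eA : encoding A} (a : A) : 1 < wt a.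
Proof. exact: leq_trans _ (wt_ge3 a). Qed.

Lemma polytimeI A B {eA : encoding A} {eB : encoding B} (f : A -> B) c (T : nat -> nat) :
  deterministic c -> poly_bounded T ->
  (forall s a, s 0 = encode a ->
     exists t s', [/\ exec c s t s', s' 0 = encode (f a),
       t <= T (wt a) & wt (f a) <= T (wt a)]) ->
  polytime f.
Proof.
move=> det_c [e Te] H; exists c, e; split=> // s a /H [t [s' [cs s'0 tT fT]]].
by exists t, s'; split=> //; apply: leq_trans _ (Te _ (wt_gt1 _)).
Qed.

Lemma polytime_wt A B {eA : encoding A} {eB : encoding B} (f : A -> B) :
  polytime f -> exists e, forall a, wt (f a) <= wt a ^ e.
Proof.
move=> [c [e [_ H]]]; exists e => a.
by have [t [s' [_ _ _]]] := H (fun=> encode a) a erefl.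
Qed.

Lemma polytime_id A {eA : encoding A} : polytime (fun a : A => a).
Proof.
apply: (@polytimeI _ _ _ _ _ (CCopy 0 0) id) => // [|s a s0]; first by poly_bound.
exists 1, (set_var s 0 (s 0)); split=> //; first by constructor.
exact: ltnW (wt_gt1 _).
Qed.

Lemma polytime_comp A B D {eA : encoding A} {eB : encoding B} {eD : encoding D}
    (g : B -> D) (f : A -> B) :
  polytime g -> polytime f -> polytime (fun a => g (f a)).
Proof.
move=> [cg [eg [dg Hg]]] [cf [ef [df Hf]]].
apply: (@polytimeI _ _ _ _ _ (CSeq cf cg)
   (fun X => (X ^ ef + (X ^ ef) ^ eg).+1)) => /=; first by rewrite df dg.
  by poly_bound.
move=> s a s0; have [t1 [s1 [x1 r1 l1 w1]]] := Hf s a s0.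
have [t2 [s2 [x2 r2 l2 w2]]] := Hg s1 (f a) r1.
have w3 : wt (f a) ^ eg <= (wt a ^ ef) ^ eg by case: (eg) => // e; rewrite leq_exp2r.
exists (t1 + t2).+1, s2; split=> //; first exact: ExecSeq x1 x2.
  by rewrite ltnS leq_add // (leq_trans l2).
by apply: leq_trans (leq_trans w2 w3) _; rewrite leqW // leq_addl.
Qed.

Lemma exec_call o c s s1 t s1' :
  exec c s1 t s1' -> (forall x, s (o + x) = s1 x) ->
  exec (shift_cmd o c) s t (glue_store o s s1').
Proof.
move=> /(exec_shift o) /(_ s) + E; have -> // : glue_store o s s1 = s.
by apply: funext => x; rewrite /glue_store; case: ltnP => // ox; rewrite -E subnKC.
Qed.

Lemma polytime_call A B {eA : encoding A} {eB : encoding B} (f : A -> B) :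
  polytime f -> exists c e, deterministic c /\ forall o s a, s o = encode a ->
    exists t s', [/\ exec (shift_cmd o c) s t s', s' o = encode (f a),
      forall x, x < o -> s' x = s x,
      t <= wt a ^ e & wt (f a) <= wt a ^ e].
Proof.
move=> [c [e [dc H]]]; exists c, e; split=> // o s a so.
have [|t [s' [x r l w]]] := H (fun x => s (o + x)) a; first by rewrite addn0.
exists t, (glue_store o s s'); split=> //; first exact: (exec_call x).
  by rewrite /glue_store ltnn subnn.
by move=> y yo; rewrite /glue_store yo.
Qed.

Lemma polytime_pair A B D {eA : encoding A} {eB : encoding B} {eD : encoding D}
    (f : A -> B) (g : A -> D) :
  polytime f -> polytime g -> polytime (fun a => (f a, g a)).
Proof.
move=> /polytime_call [cf [ef [df Hf]]] /polytime_call [cg [eg [dg Hg]]].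
apply: (@polytimeI _ _ _ _ _
  (CSeq (CCopy 2 0) (CSeq (shift_cmd 2 cf) (CSeq (CCopy 1 2) (CSeq (CCopy 2 0)
     (CSeq (shift_cmd 2 cg) (CNode 0 1 2))))))
  (fun X => X ^ ef + X ^ eg + 9)) => /=.
- by rewrite !shift_deterministic df dg.
- by poly_bound.
move=> s a s0; set s1 := set_var s 2 (s 0).
have [t1 [s2 [x1 r1 k1 l1 w1]]] := Hf 2 s1 a s0.
set s3 := set_var s2 1 (s2 2); set s4 := set_var s3 2 (s3 0).
have s40 : s4 2 = encode a by rewrite /s4 /s3 /set_var /= k1.
have [t2 [s5 [x2 r2 k2 l2 w2]]] := Hg 2 s4 a s40.
exists (1 + (t1 + (1 + (1 + (t2 + 1).+1).+1).+1).+1).+1, (set_var s5 0 (Node (s5 1) (s5 2))).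
split.
- apply: ExecSeq (ExecCopy _ _ _) _; apply: ExecSeq x1 _.
  apply: ExecSeq (ExecCopy _ _ _) _; apply: ExecSeq (ExecCopy _ _ _) _.
  by apply: ExecSeq x2 _; constructor.
- by rewrite /set_var /= k2 // r2 /s4 /s3 /set_var /= r1.
- lia.
rewrite /wt /= -/(encode (f a)) -/(encode (g a)) -/(wt (f a)) -/(wt (g a)).
by move: w1 w2; rewrite /wt; lia.
Qed.

Lemma polytime_if A B {eA : encoding A} {eB : encoding B}
    (t : A -> bool) (f g : A -> B) :
  polytime t -> polytime f -> polytime g ->
  polytime (fun a => if t a then f a else g a).
Proof.
move=> /polytime_call [ct [et [dt Ht]]] [cf [ef [df Hf]]] [cg [eg [dg Hg]]].
apply: (@polytimeI _ _ _ _ _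
  (CSeq (CCopy 1 0) (CSeq (shift_cmd 1 ct) (CIf 1 cf cg)))
  (fun X => X ^ et + X ^ ef + X ^ eg + 9)) => /=.
- by rewrite !shift_deterministic dt df dg.
- by poly_bound.
move=> s a s0; set s1 := set_var s 1 (s 0).
have [t1 [s2 [x1 r1 k1 l1 w1]]] := Ht 1 s1 a s0.
have s20 : s2 0 = encode a by rewrite k1.
have E : is_node (s2 1) = t a by rewrite r1 /encode /=; case: (t a).
have [t2 [s3 [x2 r2 l2]]] : exists t2 s3,
   [/\ exec (if t a then cf else cg) s2 t2 s3, s3 0 = encode (if t a then f a else g a),
   t2 <= wt a ^ ef + wt a ^ eg &
   wt (if t a then f a else g a) <= wt a ^ ef + wt a ^ eg].
  case: (t a).
    have [t2 [s3 [x2 r2 l2 w2]]] := Hf s2 a s20.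
    by exists t2, s3; split=> //; lia.
  have [t2 [s3 [x2 r2 l2 w2]]] := Hg s2 a s20.
  by exists t2, s3; split=> //; lia.
move=> w2; exists (1 + (t1 + t2.+1).+1).+1, s3; split=> //; [|lia|lia].
apply: ExecSeq (ExecCopy _ _ _) _; apply: ExecSeq x1 _; apply: ExecIf.
by rewrite E.
Qed.


Fixpoint const_cmd (o : nat) (u : tree) : cmd :=
  if u is Node l r then
    CSeq (const_cmd o l) (CSeq (const_cmd o.+1 r) (CNode o o o.+1))
  else CLeaf o.

Lemma const_cmd_deterministic o u : deterministic (const_cmd o u).
Proof. by elim: u o => //= l IHl r IHr o; rewrite IHl IHr. Qed.

(** The order of quantifiers matters: [t] is chosen before the store, so loading the encoded
    constant [C] later costs a fixed time that the threshold on [n] absorbs. *)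
Lemma exec_const u : exists t, forall o s, exists s',
  [/\ exec (const_cmd o u) s t s', s' o = u & forall x, x < o -> s' x = s x].
Proof.
elim: u => [|l [tl Hl] r [tr Hr]].
  exists 1 => o s; exists (set_var s o Leaf).
  split; [by constructor | by rewrite /set_var eqxx |].
  by move=> x xo; rewrite /set_var ltn_eqF.
exists (tl + (tr + 1).+1).+1 => o s.
have [s1 [x1 r1 k1]] := Hl o s; have [s2 [x2 r2 k2]] := Hr o.+1 s1.
exists (set_var s2 o (Node (s2 o) (s2 o.+1))); split.
- by apply: ExecSeq x1 _; apply: ExecSeq x2 _; constructor.
- by rewrite /set_var eqxx k2 // r1 r2.
- by move=> x xo; rewrite /set_var ltn_eqF // k2 ?k1 // ltnS ltnW.
Qed.

Lemma polytime_const A B {eA : encoding A} {eB : encoding B} (b : B) :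
  polytime (fun _ : A => b).
Proof.
have [t Ht] := exec_const (encode b).
apply: (@polytimeI _ _ _ _ _ (const_cmd 0 (encode b)) (fun=> t + wt b)).
- exact: const_cmd_deterministic.
- by poly_bound.
move=> s a _; have [s' [x r _]] := Ht 0 s; exists t, s'; split=> //.
  exact: leq_addr.
exact: leq_addl.
Qed.

Lemma polytime_atom A B {eA : encoding A} {eB : encoding B} (f : A -> B) c (g : tree -> tree) :
  deterministic c -> (forall s, exec c s 1 (set_var s 0 (g (s 0)))) ->
  (forall t, weight (g t) <= weight t) ->
  (forall a, encode (f a) = g (encode a)) -> polytime f.
Proof.
move=> dc xc wg fg; apply: (@polytimeI _ _ _ _ _ c id) => // [|s a s0].
  by poly_bound.
exists 1, (set_var s 0 (g (s 0))); rewrite /set_var /= s0 fg; split=> //.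
- by rewrite -s0; exact: xc.
- exact: ltnW (wt_gt1 _).
- by rewrite /wt fg.
Qed.

Lemma polytime_cast A B {eA : encoding A} {eB : encoding B} (f : A -> B) :
  (forall a, encode (f a) = encode a) -> polytime f.
Proof. by apply: (@polytime_atom _ _ _ _ _ (CCopy 0 0) id) => // s; constructor. Qed.

Lemma polytime_left A B {eA : encoding A} {eB : encoding B} (f : A -> B) :
  (forall a, encode (f a) = left_tree (encode a)) -> polytime f.
Proof.
apply: (@polytime_atom _ _ _ _ _ (CLeft 0 0) left_tree) => // [s|[//|l r]].
  by constructor.
exact: leq_addr.
Qed.

Lemma polytime_right A B {eA : encoding A} {eB : encoding B} (f : A -> B) :
  (forall a, encode (f a) = right_tree (encode a)) -> polytime f.
Proof.
apply: (@polytime_atom _ _ _ _ _ (CRight 0 0) right_tree) => // [s|[//|l r]].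
  by constructor.
exact: leq_addl.
Qed.

Lemma polytime_is_node A {eA : encoding A} (f : A -> bool) :
  (forall a, f a = is_node (encode a)) -> polytime f.
Proof.
move=> Hf; apply: (@polytimeI _ _ _ _ _
   (CIf 0 (CSeq (CLeaf 1) (CNode 0 1 1)) (CLeaf 0)) (fun=> 6)) => //.
  by poly_bound.
move=> s a s0; have Ef : is_node (s 0) = f a by rewrite s0 Hf.
have w6 : wt (f a) <= 6 by case: (f a).
case: (f a) Ef w6 => Ef w6.
  set s1 := set_var s 1 Leaf; exists 4, (set_var s1 0 (Node (s1 1) (s1 1))).
  split=> //; apply: ExecIf; rewrite Ef.
  by apply: (@ExecSeq _ _ _ 1 _ 1); constructor.
exists 2, (set_var s 0 Leaf).
by split=> //; apply: ExecIf; rewrite Ef; constructor.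
Qed.

Lemma wt_pair A B {eA : encoding A} {eB : encoding B} (z : A * B) :
  wt z = wt z.1 + wt z.2.
Proof. by []. Qed.

Lemma wt_cons A {eA : encoding A} (a : A) l : wt (a :: l) = wt a + wt l.
Proof. by []. Qed.

Lemma wt_bool (b : bool) : wt b <= 6.
Proof. by case: b. Qed.

Lemma wt_nat (n : nat) : wt n = 3 + 6 * n.
Proof.
elim: n => // n IHn; rewrite mulnS addnCA -IHn.
by rewrite /wt /encode /= /encoding_nat /tree_of_unary.
Qed.

Lemma wt_bits_le (s : seq bool) : wt s <= 3 + 6 * size s.
Proof.
by elim: s => // b s IHs; rewrite wt_cons /= mulnS addnCA leq_add // wt_bool.
Qed.

Lemma wt_seq_ge A {eA : encoding A} (l : seq A) : 3 + 3 * size l <= wt l.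
Proof.
by elim: l => // a l IHl; pose proof (wt_ge3 a); rewrite wt_cons; simpl size; lia.
Qed.

Lemma size_wt A {eA : encoding A} (l : seq A) : size l <= wt l.
Proof. by apply: leq_trans (wt_seq_ge l); lia. Qed.

Lemma wt_seq_le A {eA : encoding A} (l : seq A) W :
  all (fun a => wt a <= W) l -> wt l <= 3 + W * size l.
Proof.
elim: l => // a l IHl /= /andP[aW /IHl lW].
by rewrite wt_cons mulnS addnCA leq_add.
Qed.

(** Register 0 holds the parameter, 1 the rest of the list, 2 the accumulator; the argument of the
    step function is assembled in 3, and that function works from 3 upwards. *)
Definition foldl_body ch : cmd :=
  CSeq (CLeft 3 1) (CSeq (CNode 3 2 3) (CSeq (CNode 3 0 3)
    (CSeq (shift_cmd 3 ch) (CSeq (CCopy 2 3) (CRight 1 1))))).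

Lemma exec_foldl X A B {eX : encoding X} {eA : encoding A} {eB : encoding B}
    (h : X -> B -> A -> B) ch e x (W : nat) :
  (forall o s (z : X * (B * A)), s o = encode z ->
    exists t s', [/\ exec (shift_cmd o ch) s t s',
      s' o = encode (h z.1 z.2.1 z.2.2),
      forall y, y < o -> s' y = s y & t <= wt z ^ e]) ->
  forall l acc s, s 0 = encode x -> s 1 = encode l -> s 2 = encode acc ->
  wt x + wt l <= W ->
  (forall l1 l2, l = l1 ++ l2 -> wt (foldl (h x) acc l1) <= W) ->
  exists t s', [/\ exec (CWhile 1 (foldl_body ch)) s t s',
    s' 2 = encode (foldl (h x) acc l) & t <= size l * ((W + W) ^ e + 11) + 1].
Proof.
move=> Hh; elim=> [|a l IHl] acc s s0 s1 s2 lW accW.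
  by exists 1, s; split=> //; apply: ExecWhile0; rewrite s1.
set u1 := set_var s 3 (left_tree (s 1)).
set u2 := set_var u1 3 (Node (u1 2) (u1 3)).
set u3 := set_var u2 3 (Node (u2 0) (u2 3)).
have u33 : u3 3 = encode (x, (acc, a)).
  by rewrite /u3 /u2 /u1 /set_var /= s0 s1 s2.
have [t [u4 [x4 r4 k4 t4]]] := Hh 3 u3 (x, (acc, a)) u33.
set u5 := set_var u4 2 (u4 3); set u6 := set_var u5 1 (right_tree (u5 1)).
have [||||| t' [s' [x' r' l']]] := IHl (h x acc a) u6.
- by rewrite /u6 /u5 /set_var /= k4.
- by rewrite /u6 /u5 /set_var /= k4 // /u3 /u2 /u1 /set_var /= s1.
- by rewrite /u6 /u5 /set_var /= r4.
- by apply: leq_trans lW; rewrite wt_cons; lia.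
- by move=> l1 l2 El; apply: (accW (a :: l1) l2); rewrite El.
exists ((1 + (1 + (1 + (t + (1 + 1).+1).+1).+1).+1).+1 + t').+1, s'; split=> //.
  apply: ExecWhileS x'; first by rewrite s1.
  apply: ExecSeq (ExecLeft _ _ _) _; apply: ExecSeq (ExecNode _ _ _ _) _.
  apply: ExecSeq (ExecNode _ _ _ _) _; apply: ExecSeq x4 _.
  by apply: ExecSeq (ExecCopy _ _ _) _; constructor.
have tW : t <= (W + W) ^ e.
  apply: leq_trans t4 _; case: (e) => // e'; rewrite leq_exp2r // !wt_pair /=.
  have := accW [::] (a :: l) erefl; move: lW; rewrite wt_cons /=; lia.
by rewrite /= mulSn; lia.
Qed.

(** A polynomial-time step may square its accumulator at every round, so iteration alone does not
    preserve polynomial time; hence the bound [G] on the accumulators of all prefixes, which gives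
    all rounds a common time bound. *)
Lemma polytime_foldl X A B {eX : encoding X} {eA : encoding A} {eB : encoding B}
    (h : X -> B -> A -> B) (i : X -> B) (l : X -> seq A) (G : nat -> nat) :
  polytime i -> polytime l ->
  polytime (fun z : X * (B * A) => h z.1 z.2.1 z.2.2) ->
  poly_bounded G ->
  (forall x l1 l2, l x = l1 ++ l2 -> wt (foldl (h x) (i x) l1) <= G (wt x)) ->
  polytime (fun x => foldl (h x) (i x) (l x)).
Proof.
move=> /polytime_call [ci [ei [di Hi]]] /polytime_call [cl [el [dl Hl]]].
move=> /polytime_call [ch [eh [dh Hh]]] pS HS.
pose W n := n + n ^ el + G n.
apply: (@polytimeI _ _ _ _ _
  (CSeq (CCopy 3 0) (CSeq (shift_cmd 3 cl) (CSeq (CCopy 1 3)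
  (CSeq (CCopy 3 0) (CSeq (shift_cmd 3 ci) (CSeq (CCopy 2 3)
  (CSeq (CWhile 1 (foldl_body ch)) (CCopy 0 2))))))))
  (fun n => n ^ el + n ^ ei + n ^ el * ((W n + W n) ^ eh + 11) + 20 + G n)).
- by rewrite /= !shift_deterministic di dl dh.
- by rewrite /W; poly_bound.
move=> s x s0; set s1 := set_var s 3 (s 0).
have [t1 [s2 [x1 r1 k1 l1 w1]]] := Hl 3 s1 x s0.
set s3 := set_var s2 1 (s2 3); set s4 := set_var s3 3 (s3 0).
have s43 : s4 3 = encode x by rewrite /s4 /s3 /set_var /= k1.
have [t2 [s5 [x2 r2 k2 l2 w2]]] := Hi 3 s4 x s43.
set s6 := set_var s5 2 (s5 3).
have [||||||t3 [s7 [x3 r3 l3]]] :=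
   @exec_foldl _ _ _ _ _ _ h ch eh x (W (wt x)) _ (l x) (i x) s6.
- move=> o u z uo; have [t [s' [Hx Hr Hk Ht _]]] := Hh o u z uo.
  by exists t, s'; split.
- by rewrite /s6 /set_var /= k2 // /s4 /s3 /set_var /= k1.
- by rewrite /s6 /set_var /= k2 // /s4 /s3 /set_var /= r1.
- by rewrite /s6 /set_var /= r2.
- by rewrite /W; lia.
- by move=> la lb /HS; rewrite /W; lia.
exists (1 + (t1 + (1 + (1 + (t2 + (1 + (t3 + 1).+1).+1).+1).+1).+1).+1).+1.
exists (set_var s7 0 (s7 2)); split=> //.
- apply: ExecSeq (ExecCopy _ _ _) _; apply: ExecSeq x1 _.
  apply: ExecSeq (ExecCopy _ _ _) _; apply: ExecSeq (ExecCopy _ _ _) _.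
  apply: ExecSeq x2 _; apply: ExecSeq (ExecCopy _ _ _) _.
  by apply: ExecSeq x3 _; constructor.
- have szl : size (l x) <= wt x ^ el.
    exact: leq_trans (size_wt _) w1.
  move: l3; set Z := _ + 11 => l3.
  have szM : size (l x) * Z <= wt x ^ el * Z by rewrite leq_mul2r szl orbT.
  by move: szM l1 l2 l3; clearbody Z; lia.
- by apply: leq_trans (HS x (l x) [::] _) _; rewrite ?cats0 // leq_addl.
Qed.

End Combinators.

#[global] Instance encoding_unit : encoding unit := fun=> Leaf.

(** * Polynomial-time expressions on bits, options, lists and unary numbers *)

Section Lifted.

Local Open Scope nat_scope.

Lemma eq_polytime A B {eA : encoding A} {eB : encoding B} (f g : A -> B) :
  f =1 g -> polytime f -> polytime g.
Proof. by move=> /funext ->. Qed.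

Context X {eX : encoding X}.

Lemma polytime_fst A B {eA : encoding A} {eB : encoding B} (f : X -> A * B) :
  polytime f -> polytime (fun x => (f x).1).
Proof. by move=> Pf; apply: (polytime_comp _ Pf); apply: polytime_left. Qed.

Lemma polytime_snd A B {eA : encoding A} {eB : encoding B} (f : X -> A * B) :
  polytime f -> polytime (fun x => (f x).2).
Proof. by move=> Pf; apply: (polytime_comp _ Pf); apply: polytime_right. Qed.

Lemma polytime_cons A {eA : encoding A} (f : X -> A) (g : X -> seq A) :
  polytime f -> polytime g -> polytime (fun x => f x :: g x).
Proof.
move=> Pf Pg; have := polytime_pair Pf Pg.
by apply: (polytime_comp (g := fun z : A * seq A => z.1 :: z.2)); apply: polytime_cast.
Qed.

Lemma polytime_some A {eA : encoding A} (f : X -> A) :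
  polytime f -> polytime (fun x => Some (f x)).
Proof.
move=> Pf.
apply: (polytime_comp (g := fun z : A * unit => Some z.1) (f := fun x => (f x, tt))).
  exact: polytime_cast.
by apply: polytime_pair => //; apply: polytime_const.
Qed.

Lemma polytime_nseq (f : X -> nat) :
  polytime f -> polytime (fun x => nseq (f x) true).
Proof. by apply: (polytime_comp (g := fun n => nseq n true)); apply: polytime_cast. Qed.

Lemma polytime_succ (f : X -> nat) : polytime f -> polytime (fun x => (f x).+1).
Proof.
move=> [c [e H]].
have : polytime (fun x => true :: nseq (f x) true).
  by apply: polytime_cons; [exact: polytime_const | apply: polytime_nseq; exists c, e].
by move=> {c e H} [c [e H]]; exists c, e.
Qed.

Lemma polytime_pred (f : X -> nat) : polytime f -> polytime (fun x => (f x).-1).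
Proof. by move=> Pf; apply: (polytime_comp _ Pf); apply: polytime_right; case. Qed.

Lemma polytime_behead A {eA : encoding A} (f : X -> seq A) :
  polytime f -> polytime (fun x => behead (f x)).
Proof. by move=> Pf; apply: (polytime_comp _ Pf); apply: polytime_right; case. Qed.

(** [left_tree Leaf] is [Leaf], so with a default encoded by [Leaf] a single [CLeft] also covers the
    empty list. *)
Lemma polytime_head A {eA : encoding A} (a : A) (f : X -> seq A) :
  encode a = Leaf -> polytime f -> polytime (fun x => head a (f x)).
Proof.
by move=> a0 Pf; apply: (polytime_comp _ Pf); apply: polytime_left; case.
Qed.

Lemma polytime_odflt A {eA : encoding A} (a : A) (f : X -> option A) :
  encode a = Leaf -> polytime f -> polytime (fun x => odflt a (f x)).
Proof.
by move=> a0 Pf; apply: (polytime_comp _ Pf); apply: polytime_left; case.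
Qed.

Lemma polytime_isSome A {eA : encoding A} (f : X -> option A) :
  polytime f -> polytime (fun x => isSome (f x)).
Proof. by move=> Pf; apply: (polytime_comp _ Pf); apply: polytime_is_node; case. Qed.

Lemma polytime_neg (f : X -> bool) : polytime f -> polytime (fun x => ~~ f x).
Proof.
by move=> Pf; apply: (polytime_if (f := fun=> false) (g := fun=> true) Pf);
  apply: polytime_const.
Qed.

Lemma polytime_and (f g : X -> bool) :
  polytime f -> polytime g -> polytime (fun x => f x && g x).
Proof.
by move=> Pf Pg; apply: (polytime_if (g := fun=> false) Pf Pg); apply: polytime_const.
Qed.

Lemma polytime_or (f g : X -> bool) :
  polytime f -> polytime g -> polytime (fun x => f x || g x).
Proof.
by move=> Pf Pg; apply: (polytime_if (f := fun=> true) Pf _ Pg); apply: polytime_const.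
Qed.

Lemma polytime_addb (f g : X -> bool) :
  polytime f -> polytime g -> polytime (fun x => f x (+) g x).
Proof.
move=> Pf Pg; apply: (@eq_polytime _ _ _ _ (fun x => if f x then ~~ g x else g x)).
  by move=> x; case: (f x).
by apply: polytime_if => //; apply: polytime_neg.
Qed.

Lemma polytime_nat_of_bool (f : X -> bool) :
  polytime f -> polytime (fun x => nat_of_bool (f x)).
Proof.
move=> Pf; apply: (@eq_polytime _ _ _ _ (fun x => if f x then 1 else 0)).
  by move=> x; case: (f x).
by apply: polytime_if => //; apply: polytime_const.
Qed.

Lemma polytime_eq0 (f : X -> nat) : polytime f -> polytime (fun x => f x == 0).
Proof.
move=> Pf; apply: (@eq_polytime _ _ _ _ (fun x => ~~ ~~ (f x == 0))).
  by move=> x; rewrite negbK.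
apply: polytime_neg; apply: (polytime_comp (g := fun n => n != 0)) => //.
by apply: polytime_is_node; case.
Qed.

Lemma polytime_foldl_wt A B {eA : encoding A} {eB : encoding B}
    (h : X -> B -> A -> B) (i : X -> B) (l : X -> seq A) W :
  polytime i -> polytime l ->
  polytime (fun z : X * (B * A) => h z.1 z.2.1 z.2.2) ->
  (forall b : B, wt b <= W) ->
  polytime (fun x => foldl (h x) (i x) (l x)).
Proof.
move=> Pi Pl Ph HW; apply: (@polytime_foldl _ _ _ _ _ _ h i l (fun=> W)) => //.
by poly_bound.
Qed.

Lemma polytime_iter B {eB : encoding B} (h : X -> B -> B) (i : X -> B) (n : X -> nat) G :
  polytime i -> polytime n ->
  polytime (fun z : X * B => h z.1 z.2) -> poly_bounded G ->
  (forall x j, j <= n x -> wt (iter j (h x) (i x)) <= G (wt x)) ->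
  polytime (fun x => iter (n x) (h x) (i x)).
Proof.
have iterE x (s : seq bool) b : foldl (fun b (_ : bool) => h x b) b s = iter (size s) (h x) b.
  by elim: s b => // a s IHs b; rewrite [LHS]/= IHs -iterSr.
move=> Pi Pn Ph pG HG.
apply: (@eq_polytime _ _ _ _
   (fun x => foldl (fun b (_ : bool) => h x b) (i x) (nseq (n x) true))).
  by move=> x; rewrite iterE size_nseq.
apply: (@polytime_foldl _ _ _ _ _ _ (fun x b _ => h x b) i
   (fun x => nseq (n x) true) G) => //.
  apply: (polytime_comp (g := fun z : X * B => h z.1 z.2)
    (f := fun z : X * (B * bool) => (z.1, z.2.1))) => //.
  apply: polytime_pair; first exact: polytime_left.
  apply: (polytime_comp (g := fst) (f := snd)); first exact: polytime_left.
  exact: polytime_right.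
move=> x l1 l2 El; rewrite iterE HG //.
by have := congr1 size El; rewrite size_cat size_nseq => ->; apply: leq_addr.
Qed.

End Lifted.

(** Decomposition by the shape of the body: the second-order patterns expose subterms as functions
    of the input. The last rule handles a named function whose polynomial time is a hypothesis. *)
Ltac polytime_core :=
  match goal with
  | |- polytime (fun x => x) => exact: polytime_id
  | |- polytime (fun=> _) => exact: polytime_const
  | |- polytime id => exact: polytime_id
  | |- polytime fst => exact: polytime_left
  | |- polytime snd => exact: polytime_right
  | H : polytime ?f |- polytime ?f => exact: H
  | |- polytime (fun x => (@?f x, @?g x)) => refine (polytime_pair (f := f) (g := g) _ _)
  | |- polytime (fun x => fst (@?f x)) => refine (polytime_fst (f := f) _)
  | |- polytime (fun x => snd (@?f x)) => refine (polytime_snd (f := f) _)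
  | |- polytime (fun x => @?f x :: @?g x) => refine (polytime_cons (f := f) (g := g) _ _)
  | |- polytime (fun x => Some (@?f x)) => refine (polytime_some (f := f) _)
  | |- polytime (fun x => (@?f x).+1) => refine (polytime_succ (f := f) _)
  | |- polytime (fun x => (@?f x).-1) => refine (polytime_pred (f := f) _)
  | |- polytime (fun x => behead (@?f x)) => refine (polytime_behead (f := f) _)
  | |- polytime (fun x => head ?a (@?f x)) => refine (polytime_head (a := a) (f := f) erefl _)
  | |- polytime (fun x => odflt ?a (@?f x)) =>
      refine (polytime_odflt (a := a) (f := f) erefl _)
  | |- polytime (fun x => isSome (@?f x)) => refine (polytime_isSome (f := f) _)
  | |- polytime (fun x => ~~ (@?f x)) => refine (polytime_neg (f := f) _)
  | |- polytime (fun x => (@?f x) && (@?g x)) => refine (polytime_and (f := f) (g := g) _ _)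
  | |- polytime (fun x => (@?f x) || (@?g x)) => refine (polytime_or (f := f) (g := g) _ _)
  | |- polytime (fun x => addb (@?f x) (@?g x)) => refine (polytime_addb (f := f) (g := g) _ _)
  | |- polytime (fun x => nat_of_bool (@?f x)) => refine (polytime_nat_of_bool (f := f) _)
  | |- polytime (fun x => @?f x == 0) => refine (polytime_eq0 (f := f) _)
  | H : polytime ?g |- polytime (fun x => ?g (@?f x)) => refine (polytime_comp (f := f) H _)
  end; cbv beta.

(** * Arithmetic on unary numbers by iteration *)

Section Arithmetic.

Local Open Scope nat_scope.

Lemma polytime_addn0 : polytime (fun z : nat * nat => z.1 + z.2).
Proof.
apply: (@eq_polytime _ _ _ _ (fun z => iter z.1 S z.2)) => [z|].
  by rewrite iter_succn addnC.
apply: (@polytime_iter _ _ _ _ (fun=> S) snd fst id); repeat polytime_core.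
  by poly_bound.
by move=> z j jz; rewrite iter_succn wt_pair !wt_nat; lia.
Qed.

Lemma polytime_add X {eX : encoding X} (f g : X -> nat) :
  polytime f -> polytime g -> polytime (fun x => f x + g x).
Proof.
move=> Pf Pg.
exact: (polytime_comp (f := fun x => (f x, g x)) polytime_addn0 (polytime_pair Pf Pg)).
Qed.

Lemma polytime_subn0 : polytime (fun z : nat * nat => z.1 - z.2).
Proof.
have iter_pred n j : iter j predn n = n - j.
  by elim: j => [|j IHj]; rewrite ?subn0 // iterS IHj subnS.
apply: (@eq_polytime _ _ _ _ (fun z => iter z.2 predn z.1)) => [z|].
  exact: iter_pred.
apply: (@polytime_iter _ _ _ _ (fun=> predn) fst snd id); repeat polytime_core.
  by poly_bound.
by move=> z j jz; rewrite iter_pred wt_pair !wt_nat; lia.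
Qed.

Lemma polytime_sub X {eX : encoding X} (f g : X -> nat) :
  polytime f -> polytime g -> polytime (fun x => f x - g x).
Proof.
move=> Pf Pg.
exact: (polytime_comp (f := fun x => (f x, g x)) polytime_subn0 (polytime_pair Pf Pg)).
Qed.

Lemma polytime_leq X {eX : encoding X} (f g : X -> nat) :
  polytime f -> polytime g -> polytime (fun x => f x <= g x).
Proof. by move=> Pf Pg; apply: polytime_eq0; apply: polytime_sub. Qed.

Lemma polytime_eqn X {eX : encoding X} (f g : X -> nat) :
  polytime f -> polytime g -> polytime (fun x => f x == g x).
Proof.
move=> Pf Pg; apply: (@eq_polytime _ _ _ _ (fun x => (f x <= g x) && (g x <= f x))) => [x|].
  by rewrite -eqn_leq.
by apply: polytime_and; apply: polytime_leq.
Qed.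

End Arithmetic.
Section ArithmeticSeq.

Local Open Scope nat_scope.

Lemma polytime_muln0 : polytime (fun z : nat * nat => z.1 * z.2).
Proof.
apply: (@eq_polytime _ _ _ _ (fun z => iter z.1 (addn z.2) 0)) => [z|].
  by rewrite iter_addn_0 mulnC.
apply: (@polytime_iter _ _ _ _ (fun z => addn z.2) (fun=> 0) fst (fun n => 3 + 6 * (n * n))).
- by repeat polytime_core.
- by repeat polytime_core.
- by apply: (@polytime_add _ _ (fun z => z.1.2) snd); repeat polytime_core.
- by poly_bound.
move=> z j jz; rewrite iter_addn_0 wt_pair !wt_nat.
have : z.2 * j <= z.2 * z.1 by rewrite leq_mul2l jz orbT.
nia.
Qed.

Lemma polytime_mul X {eX : encoding X} (f g : X -> nat) :
  polytime f -> polytime g -> polytime (fun x => f x * g x).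
Proof.
move=> Pf Pg.
exact: (polytime_comp (f := fun x => (f x, g x)) polytime_muln0 (polytime_pair Pf Pg)).
Qed.

(** Division by counting up. For [d = 0] the test never succeeds, which yields [(0, n)], in
    agreement with [n %/ 0] and [n %% 0]. *)
Definition divmod_step (d : nat) (z : nat * nat) : nat * nat :=
  if z.2.+1 == d then (z.1.+1, 0) else (z.1, z.2.+1).

Lemma iter_divmod_step n d :
  iter n (divmod_step d) (0, 0) = (n %/ d, n %% d).
Proof.
case: d => [|d]; first by elim: n => // n IHn; rewrite iterS IHn /divmod_step /=.
elim: n => [|n IHn]; first by rewrite div0n mod0n.
rewrite iterS IHn /divmod_step /=.
have rd := ltn_pmod n (isT : 0 < d.+1).
have En := divn_eq n d.+1.
case: eqP => E.
  have -> : n.+1 = (n %/ d.+1).+1 * d.+1.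
    by rewrite {1}En -addnS E addnC.
  by rewrite mulnK // modnMl.
have rd' : (n %% d.+1).+1 < d.+1 by move: rd; rewrite leq_eqVlt => /orP[/eqP|].
have -> : n.+1 = n %/ d.+1 * d.+1 + (n %% d.+1).+1 by rewrite {1}En -addnS.
by rewrite divnMDl // modnMDl (divn_small rd') (modn_small rd') addn0.
Qed.

Lemma polytime_divmod : polytime (fun z : nat * nat => (z.1 %/ z.2, z.1 %% z.2)).
Proof.
apply: (@eq_polytime _ _ _ _ (fun z => iter z.1 (divmod_step z.2) (0, 0))) => [z|].
  exact: iter_divmod_step.
apply: (@polytime_iter _ _ _ _ (fun z => divmod_step z.2) (fun=> (0, 0)) fst
   (fun n => 6 + 6 * n + 6 * n)).
- by repeat polytime_core.
- by repeat polytime_core.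
- apply: (@polytime_if _ _ _ _ (fun z : nat * nat * (nat * nat) => z.2.2.+1 == z.1.2)
    (fun z => (z.2.1.+1, 0)) (fun z => (z.2.1, z.2.2.+1))); repeat polytime_core.
  by apply: (@polytime_eqn _ _ (fun z : nat * nat * (nat * nat) => z.2.2.+1) (fun z => z.1.2));
     repeat polytime_core.
- by poly_bound.
move=> z j jz; rewrite iter_divmod_step !wt_pair !wt_nat /=.
by have := leq_div j z.2; have := leq_mod j z.2; lia.
Qed.

Lemma polytime_div X {eX : encoding X} (f g : X -> nat) :
  polytime f -> polytime g -> polytime (fun x => f x %/ g x).
Proof.
move=> Pf Pg; apply: (polytime_comp (g := fst)
  (f := fun x => (f x %/ g x, f x %% g x))); first exact: polytime_left.
apply: (polytime_comp (f := fun x => (f x, g x)) polytime_divmod).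
exact: polytime_pair.
Qed.

Lemma polytime_mod X {eX : encoding X} (f g : X -> nat) :
  polytime f -> polytime g -> polytime (fun x => f x %% g x).
Proof.
move=> Pf Pg; apply: (polytime_comp (g := snd)
  (f := fun x => (f x %/ g x, f x %% g x))); first exact: polytime_right.
apply: (polytime_comp (f := fun x => (f x, g x)) polytime_divmod).
exact: polytime_pair.
Qed.

(** * List operations *)

Section Seq.

Context A {eA : encoding A}.

Lemma wt_cat (s1 s2 : seq A) : 3 + wt (s1 ++ s2) = wt s1 + wt s2.
Proof. by elim: s1 => // a s1 IH; rewrite cat_cons !wt_cons; lia. Qed.

Lemma wt_rev (s : seq A) : wt (rev s) = wt s.
Proof.
elim: s => // a s IHs; rewrite rev_cons -cats1 wt_cons.
have := wt_cat (rev s) [:: a]; rewrite IHs wt_cons.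
have -> : wt ([::] : seq A) = 3 by []. lia.
Qed.

Lemma foldl_cons (s t : seq A) : foldl (fun acc a => a :: acc) t s = rev s ++ t.
Proof. by elim: s t => // a s IHs t; rewrite /= IHs rev_cons cat_rcons. Qed.

Lemma polytime_rev X {eX : encoding X} (f : X -> seq A) :
  polytime f -> polytime (fun x => rev (f x)).
Proof.
move=> Pf; apply: (polytime_comp _ Pf).
apply: (@eq_polytime _ _ _ _ (foldl (fun acc a => a :: acc) [::])) => [s|].
  by rewrite foldl_cons cats0.
apply: (@polytime_foldl _ _ _ _ _ _ (fun _ acc a => a :: acc) (fun=> [::]) id id);
  repeat polytime_core.
  by poly_bound.
move=> s s1 s2 ->; rewrite foldl_cons cats0 wt_rev.
have := wt_cat s1 s2; pose proof (wt_ge3 s2); lia.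
Qed.

Lemma polytime_cat X {eX : encoding X} (f g : X -> seq A) :
  polytime f -> polytime g -> polytime (fun x => f x ++ g x).
Proof.
move=> Pf Pg; apply: (polytime_comp (g := fun z => z.1 ++ z.2)
  (f := fun x => (f x, g x))); last exact: polytime_pair.
apply: (@eq_polytime _ _ _ _
   (fun z => foldl (fun acc a => a :: acc) z.2 (rev z.1))) => [z|].
  by rewrite foldl_cons revK.
apply: (@polytime_foldl _ _ _ _ _ _ (fun _ acc a => a :: acc) snd
   (fun z => rev z.1) id); repeat polytime_core.
- by apply: polytime_rev; repeat polytime_core.
- by poly_bound.
move=> z s1 s2 Ez; rewrite foldl_cons wt_pair.
have := wt_cat (rev s1) z.2; rewrite -(wt_rev z.1) Ez wt_rev.
have := wt_cat s1 s2; pose proof (wt_ge3 s2); lia.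
Qed.

Lemma polytime_size X {eX : encoding X} (f : X -> seq A) :
  polytime f -> polytime (fun x => size (f x)).
Proof.
move=> Pf; apply: (polytime_comp _ Pf).
have foldl_size (s : seq A) n : foldl (fun n _ => n.+1) n s = n + size s.
  by elim: s n => [|a s IHs] n; rewrite ?addn0 //= IHs addSnnS.
apply: (@eq_polytime _ _ _ _ (foldl (fun n (_ : A) => n.+1) 0)) => [s|].
  exact: foldl_size.
apply: (@polytime_foldl _ _ _ _ _ _ (fun _ n _ => n.+1) (fun=> 0) id (fun n => 3 + 6 * n));
  repeat polytime_core.
  by poly_bound.
move=> s s1 s2 Es; rewrite foldl_size wt_nat; pose proof (wt_seq_ge s) as H.
by move: H; rewrite Es size_cat; lia.
Qed.

Lemma polytime_nth X {eX : encoding X} (a : A) (f : X -> seq A) (n : X -> nat) :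
  encode a = Leaf -> polytime f -> polytime n -> polytime (fun x => nth a (f x) (n x)).
Proof.
have iter_behead m (s : seq A) : iter m behead s = drop m s.
  elim: m => [|m IHm]; first by rewrite drop0.
  by rewrite iterS IHm -drop1 drop_drop add1n.
move=> a0 Pf Pn; apply: (polytime_comp (g := fun z => nth a z.1 z.2)
  (f := fun x => (f x, n x))); last exact: polytime_pair.
apply: (@eq_polytime _ _ _ _ (fun z => head a (iter z.2 behead z.1))) => [z|].
  by rewrite iter_behead -nth0 nth_drop addn0.
apply: polytime_head => //.
apply: (@polytime_iter _ _ _ _ (fun _ => behead) fst snd id); repeat polytime_core.
  by poly_bound.
move=> z j jz; rewrite iter_behead wt_pair.
have := wt_cat (take j z.1) (drop j z.1); rewrite cat_take_drop.
by pose proof (wt_ge3 (take j z.1)); lia.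
Qed.

Lemma polytime_filter X {eX : encoding X} (p : X -> A -> bool) (f : X -> seq A) :
  polytime (fun z : X * A => p z.1 z.2) -> polytime f ->
  polytime (fun x => [seq a <- f x | p x a]).
Proof.
move=> Pp Pf.
have foldl_filter x (s : seq A) t :
   foldl (fun acc a => if p x a then a :: acc else acc) t s = rev [seq a <- s | p x a] ++ t.
  elim: s t => // a s IHs t /=; rewrite IHs; case: (p x a) => //.
  by rewrite rev_cons cat_rcons.
apply: (@eq_polytime _ _ _ _ (fun x =>
   rev (foldl (fun acc a => if p x a then a :: acc else acc) [::] (f x)))) => [x|].
  by rewrite foldl_filter cats0 revK.
apply: polytime_rev; have [e fe] := polytime_wt Pf.
apply: (@polytime_foldl _ _ _ _ _ _ (fun x acc a => if p x a then a :: acc else acc)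
   (fun=> [::]) f (fun n => n ^ e)); repeat polytime_core.
- apply: (@polytime_if _ _ _ _ (fun z : X * (seq A * A) => p z.1 z.2.2)
    (fun z => z.2.2 :: z.2.1) (fun z => z.2.1)); repeat polytime_core.
  apply: (polytime_comp (g := fun z : X * A => p z.1 z.2)
     (f := fun z : X * (seq A * A) => (z.1, z.2.2))) => //; repeat polytime_core.
- by poly_bound.
move=> x s1 s2 Ex; rewrite foldl_filter cats0 wt_rev; apply: leq_trans (fe x).
have s1_le : wt s1 <= wt (f x).
  by rewrite Ex -(leq_add2l 3) wt_cat addnC leq_add2l wt_ge3.
apply: leq_trans s1_le.
elim: s1 {Ex} => // a s1 IH /=; case: ifP => _; rewrite !wt_cons ?leq_add2l //.
exact: leq_trans IH (leq_addl _ _).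
Qed.

End Seq.

Lemma polytime_map X A B {eX : encoding X} {eA : encoding A} {eB : encoding B}
    (h : X -> A -> B) (f : X -> seq A) :
  polytime (fun z : X * A => h z.1 z.2) -> polytime f ->
  polytime (fun x => [seq h x a | a <- f x]).
Proof.
move=> Ph Pf.
have foldl_map x (s : seq A) t :
   foldl (fun acc a => h x a :: acc) t s = rev [seq h x a | a <- s] ++ t.
  by elim: s t => // a s IHs t /=; rewrite IHs rev_cons cat_rcons.
have Pm : polytime (fun x => foldl (fun acc a => h x a :: acc) [::] (f x)).
  have [e fe] := polytime_wt Pf; have [e' he'] := polytime_wt Ph.
  apply: (@polytime_foldl _ _ _ _ _ _ (fun x acc a => h x a :: acc)
     (fun=> [::]) f (fun n => 3 + (n + n ^ e) ^ e' * n ^ e)); repeat polytime_core.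
  - apply: (polytime_comp (g := fun z : X * A => h z.1 z.2)
     (f := fun z : X * (seq B * A) => (z.1, z.2.2))) => //; repeat polytime_core.
  - by poly_bound.
  move=> x s1 s2 Ex; rewrite foldl_map cats0 wt_rev.
  have w1 : wt s1 <= wt x ^ e.
    by apply: leq_trans (fe x); rewrite Ex -(leq_add2l 3) wt_cat addnC leq_add2l wt_ge3.
  have z1 : size s1 <= wt x ^ e.
    exact: leq_trans (size_wt _) w1.
  set W := _ ^ e'.
  apply: (@leq_trans (3 + W * size [seq h x a | a <- s1])); last first.
    by rewrite size_map leq_add2l leq_mul2l z1 orbT.
  apply: wt_seq_le.
  have {}w1 : all (fun a => wt a <= wt x ^ e) s1.
    elim: s1 w1 {Ex z1} => // a s1 IH; rewrite wt_cons /= => w1.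
    rewrite IH ?andbT; first by apply: leq_trans w1; exact: leq_addr.
    by apply: leq_trans w1; exact: leq_addl.
  rewrite all_map; apply: sub_all w1 => a /= wa; apply: leq_trans (he' (x, a)) _.
  by rewrite /W; case: (e') => // k; rewrite leq_exp2r // wt_pair leq_add2l.
apply: (@eq_polytime _ _ _ _ (fun x =>
   rev (foldl (fun acc a => h x a :: acc) [::] (f x)))) => [x|].
  by rewrite foldl_map cats0 revK.
exact: polytime_rev.
Qed.

End ArithmeticSeq.

Section Iota.

Local Open Scope nat_scope.

Context X {eX : encoding X}.

Lemma polytime_iota (f : X -> nat) : polytime f -> polytime (fun x => iota 0 (f x)).
Proof.
move=> Pf; pose st (z : nat * seq nat) := (z.1.+1, z.1 :: z.2).
have stE n : iter n st (0, [::]) = (n, rev (iota 0 n)).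
  elim: n => // n IHn; have -> : iota 0 n.+1 = rcons (iota 0 n) n.
    by rewrite -addn1 iotaD cats1.
  by rewrite iterS IHn rev_rcons.
apply: (polytime_comp (g := fun n => iota 0 n)) => //.
apply: (@eq_polytime _ _ _ _ (fun n => rev (iter n st (0, [::])).2)) => [n|].
  by rewrite stE revK.
apply: polytime_rev; apply: polytime_snd.
apply: (@polytime_iter _ _ _ _ (fun _ => st) (fun=> (0, [::])) id
  (fun n => 3 + 6 * n + (3 + (3 + 6 * n) * n))); rewrite /st; repeat polytime_core.
  by poly_bound.
move=> n j jn; rewrite -/st stE wt_pair /= wt_rev !wt_nat.
have jn' : j <= 3 + 6 * n by lia.
apply: leq_add; first by lia.
apply: (@leq_trans (3 + (3 + 6 * n) * size (iota 0 j))).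
  apply: wt_seq_le; apply/allP => i; rewrite mem_iota /= add0n => ij.
  by rewrite wt_nat; lia.
by rewrite size_iota leq_add2l; nia.
Qed.

(** A Boolean accumulator weighs at most 6, so the growth condition on folds is automatic. *)
Lemma polytime_foldl_bool A {eA : encoding A}
    (h : X -> bool -> A -> bool) (i : X -> bool) (l : X -> seq A) :
  polytime i -> polytime l ->
  polytime (fun z : X * (bool * A) => h z.1 z.2.1 z.2.2) ->
  polytime (fun x => foldl (h x) (i x) (l x)).
Proof. by move=> Pi Pl Ph; apply: (@polytime_foldl_wt _ _ _ _ _ _ h i l 6) => // -[]. Qed.

End Iota.

Ltac polytime_step :=
  match goal with
  | H : polytime ?f |- polytime ?f => exact: H
  | |- polytime (fun x => @?f x == 0%N) => refine (polytime_eq0 (f := f) _)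
  | |- polytime (fun x => addn (@?f x) (@?g x)) =>
      refine (polytime_add (f := f) (g := g) _ _)
  | |- polytime (fun x => muln (@?f x) (@?g x)) =>
      refine (polytime_mul (f := f) (g := g) _ _)
  | |- polytime (fun x => divn (@?f x) (@?g x)) =>
      refine (polytime_div (f := f) (g := g) _ _)
  | |- polytime (fun x => modn (@?f x) (@?g x)) =>
      refine (polytime_mod (f := f) (g := g) _ _)
  | |- polytime (fun x => leq (@?f x) (@?g x)) =>
      refine (polytime_leq (f := f) (g := g) _ _)
  | |- polytime (fun x => eq_op (@?f x) (@?g x)) =>
      refine (polytime_eqn (f := f) (g := g) _ _)
  | |- polytime (fun x => size (@?f x)) => refine (polytime_size (f := f) _)
  | |- polytime (fun x => rev (@?f x)) => refine (polytime_rev (f := f) _)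
  | |- polytime (fun x => cat (@?f x) (@?g x)) =>
      refine (polytime_cat (f := f) (g := g) _ _)
  | |- polytime (fun x => nth ?a (@?f x) (@?g x)) =>
      refine (polytime_nth (a := a) (f := f) (n := g) erefl _ _)
  | |- polytime (fun x => iota 0 (@?f x)) => refine (polytime_iota (f := f) _)
  | |- polytime (fun x => map (@?h x) (@?f x)) =>
      refine (polytime_map (h := h) (f := f) _ _)
  | |- polytime (fun x => seq.filter (@?h x) (@?f x)) =>
      refine (polytime_filter (p := h) (f := f) _ _)
  | |- polytime (fun x => foldl (@?h x) (@?i x) (@?l x)) =>
      refine (polytime_foldl_bool (h := h) (i := i) (l := l) _ _ _)
  | _ => polytime_core
  end; cbv beta.

Ltac polytime := repeat polytime_step.

(** * The coding scheme *)

Section Scheme.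

Local Open Scope nat_scope.

(** The factor is [C.+1] because with a factor [0] the width would double at
    every iteration. *)
Definition params_step (C n : nat) (z : nat * nat) : nat * nat :=
  if C.+1 * z.1.+1 * (z.2 * 2) <= n then (z.1.+1, z.2 * 2) else z.

Definition params (C n : nat) : nat * nat := iter n (params_step C n) (0, 1).

Definition log_width (C n : nat) : nat := (params C n).1.
Definition width (C n : nat) : nat := (params C n).2.
Definition layers (C n : nat) : nat := (n %/ width C n).+1.
Definition seed_length (C n : nat) : nat :=
  layers C n * (log_width C n + layers C n).

(** [M] is always positive here: [M.-1.+1] keeps the function polynomially
    bounded on all inputs. *)
Definition rotation (m M : nat) (r : seq bool) (o : nat) : nat :=
  foldl (fun v i => (v * 2 + nth false r (o + i)) %% M.-1.+1) 0 (iota 0 m).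

(** The [j]-th block of [m + b] seed bits gives the rotation of the [j]-th layer
    of [M] cells, then the [j]-th column of a binary matrix; output [i] is the
    inner product of the row [i %/ M] of this matrix with the cells at position
    [i %% M] of the rotated layers. *)
Definition decode_bit (m M b : nat) (r x : seq bool) (i : nat) : bool :=
  foldl (fun acc j => acc (+) (nth false r (j * (m + b) + m + i %/ M) &&
     nth false x (j * M + (i %% M + rotation m M r (j * (m + b))) %% M)))
   false (iota 0 b).

Definition decode (C : nat) (r x : seq bool) (k : nat) : seq bool :=
  [seq decode_bit (log_width C (size x)) (width C (size x)) (layers C (size x)) r x i
     | i <- iota 0 k].

Fixpoint xors (s t : seq bool) : seq bool :=
  match s, t with
  | a :: s', b :: t' => a (+) b :: xors s' t'
  | _, _ => s
  end.

(** The leading coordinate is cleared and then dropped, so every round of the elimination works at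
    the head of the vectors. *)
Definition reduce (p c : seq bool) : seq bool :=
  if head false c then behead (xors c p) else behead c.

(** When no column has a leading 1 the result is [[::]], whose head is [false]; thus
    [head false (pivot cs)] tells whether a pivot exists. *)
Definition pivot (cs : seq (seq bool)) : seq bool :=
  head [::] [seq c <- cs | head false c].

(** The pivot is not removed from the columns, where it becomes zero. *)
Definition elim_step (z : bool * (seq (seq bool) * seq bool)) :=
  (z.1 && (head false (pivot z.2.1) || ~~ head false z.2.2),
   ([seq reduce (pivot z.2.1) c | c <- z.2.1], reduce (pivot z.2.1) z.2.2)).

Definition eliminate (k : nat) (cs : seq (seq bool)) (t : seq bool) :=
  iter k elim_step (true, (cs, t)).

Definition unit_bits (n i : nat) : seq bool := [seq l == i | l <- iota 0 n].

Definition free_cell (defects : seq (option bool)) (i : nat) : bool :=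
  ~~ isSome (nth None defects i).

Definition stuck_bits (defects : seq (option bool)) : seq bool :=
  [seq odflt false c | c <- defects].

(** Every vector carries its preimage by the decoder, so that what remains of
    the target after the elimination is the memory content. *)
Definition columns (C k : nat) (defects : seq (option bool)) (r : seq bool) :=
  [seq decode C r (unit_bits (size defects) i) k ++ unit_bits (size defects) i
     | i <- [seq i <- iota 0 (size defects) | free_cell defects i]].

Definition target (C : nat) (defects : seq (option bool)) (y r : seq bool) :=
  xors y (decode C r (stuck_bits defects) (size y)) ++ stuck_bits defects.

Definition attempt (C : nat) (defects : seq (option bool)) (y r : seq bool) :=
  eliminate (size y) (columns C (size y) defects r) (target C defects y r).

Lemma size_xors s t : size (xors s t) = size s.
Proof. by elim: s t => [|a s IH] [|b t] //=; rewrite IH. Qed.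

Lemma nth_xors s t i : size t <= size s ->
  nth false (xors s t) i = nth false s i (+) nth false t i.
Proof.
elim: s t i => [|a s IH] [|b t] i //=; first by rewrite nth_nil.
  by rewrite nth_nil addbF.
by case: i => // i; apply: IH.
Qed.

(** * Polynomial time of the scheme *)

Lemma polytime_params : polytime (fun z : nat * nat => params z.1 z.2).
Proof.
apply: (@polytime_iter _ _ _ _ (fun z => params_step z.1 z.2) (fun=> (0, 1)) snd
  (fun n => 3 + 6 * n + 3 + 6 * n)).
- by polytime.
- by polytime.
- apply: (@polytime_if _ _ _ _
    (fun z : nat * nat * (nat * nat) => z.1.1.+1 * z.2.1.+1 * (z.2.2 * 2) <= z.1.2)
    (fun z => (z.2.1.+1, z.2.2 * 2)) (fun z => z.2)); polytime.
- by poly_bound.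
move=> [C n] j /= jn; rewrite !wt_pair !wt_nat /=.
suff : (iter j (params_step C n) (0, 1)).1 <= j /\
  (iter j (params_step C n) (0, 1)).2 <= n.+1 by lia.
elim: j {jn} => [|j [IH1 IH2]]; first by [].
rewrite iterS; move: (iter j _ _) IH1 IH2 => [a b] /= IH1 IH2.
rewrite /params_step /=; case: ifP => [H|_] /=; last by rewrite leqW.
split; first by lia.
apply: leqW; apply: leq_trans H; apply: leq_pmull; lia.
Qed.

Lemma polytime_log_width X {eX : encoding X} (C n : X -> nat) :
  polytime C -> polytime n -> polytime (fun x => log_width (C x) (n x)).
Proof.
move=> PC Pn; apply: polytime_fst.
by apply: (polytime_comp (f := fun x => (C x, n x)) polytime_params); polytime.
Qed.

Lemma polytime_width X {eX : encoding X} (C n : X -> nat) :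
  polytime C -> polytime n -> polytime (fun x => width (C x) (n x)).
Proof.
move=> PC Pn; apply: polytime_snd.
by apply: (polytime_comp (f := fun x => (C x, n x)) polytime_params); polytime.
Qed.

Lemma polytime_layers X {eX : encoding X} (C n : X -> nat) :
  polytime C -> polytime n -> polytime (fun x => layers (C x) (n x)).
Proof.
by move=> PC Pn; have := polytime_width PC Pn; rewrite /layers => PW; polytime.
Qed.

Lemma polytime_seed_length X {eX : encoding X} (C n : X -> nat) :
  polytime C -> polytime n -> polytime (fun x => seed_length (C x) (n x)).
Proof.
move=> PC Pn; have := polytime_layers PC Pn; have := polytime_log_width PC Pn.
by rewrite /seed_length => PW PL; polytime.
Qed.

Lemma polytime_rotation X {eX : encoding X} (m M o : X -> nat) (r : X -> seq bool) :
  polytime m -> polytime M -> polytime r -> polytime o ->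
  polytime (fun x => rotation (m x) (M x) (r x) (o x)).
Proof.
move=> Pm PM Pr Po; have [e Me] := polytime_wt PM.
apply: (@polytime_foldl _ _ _ _ _ _
  (fun x v i => (v * 2 + nth false (r x) (o x + i)) %% (M x).-1.+1) (fun=> 0)
  (fun x => iota 0 (m x)) (fun n => 3 + n ^ e)).
- by polytime.
- by polytime.
- by polytime.
- by poly_bound.
move=> x l1 l2 _; apply: leq_trans (leq_add (leqnn 3) (Me x)).
rewrite !wt_nat; suff : foldl (fun v i => (v * 2 + nth false (r x) (o x + i)) %% (M x).-1.+1)
   0 l1 <= M x by lia.
have : 0 <= M x by []; move: {1 3}0 => v.
elim: l1 v => //= i l1 IH v _; apply: IH.
by have := ltn_pmod (v * 2 + nth false (r x) (o x + i)) (isT : 0 < (M x).-1.+1); lia.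
Qed.

Lemma polytime_decode_bit X {eX : encoding X} (m M b i : X -> nat) (r x : X -> seq bool) :
  polytime m -> polytime M -> polytime b -> polytime r -> polytime x -> polytime i ->
  polytime (fun z => decode_bit (m z) (M z) (b z) (r z) (x z) (i z)).
Proof.
move=> Pm PM Pb Pr Px Pi; rewrite /decode_bit.
apply: (@polytime_foldl_bool _ _ _ _ (fun z acc j => acc (+)
   (nth false (r z) (j * (m z + b z) + m z + i z %/ M z) &&
     nth false (x z) (j * M z +
       (i z %% M z + rotation (m z) (M z) (r z) (j * (m z + b z))) %% M z)))
   (fun=> false)); [by polytime|by polytime|].
polytime; apply: (@polytime_rotation _ _ (fun z : X * (bool * nat) => m z.1)
  (fun z => M z.1) (fun z => z.2.2 * (m z.1 + b z.1)) (fun z => r z.1)); polytime.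
Qed.

Lemma polytime_decode X {eX : encoding X} (C k : X -> nat) (r x : X -> seq bool) :
  polytime C -> polytime r -> polytime x -> polytime k ->
  polytime (fun z => decode (C z) (r z) (x z) (k z)).
Proof.
move=> PC Pr Px Pk; rewrite /decode; polytime.
have Px1 : polytime (fun z : X * nat => size (x z.1)) by polytime.
have PC1 : polytime (fun z : X * nat => C z.1) by polytime.
have Pm := polytime_log_width PC1 Px1; have PM := polytime_width PC1 Px1.
have Pb := polytime_layers PC1 Px1.
by apply: (@polytime_decode_bit _ _ _ _ _ snd (fun z : X * nat => r z.1) (fun z => x z.1));
   polytime.
Qed.

Lemma polytime_xors X {eX : encoding X} (s t : X -> seq bool) :
  polytime s -> polytime t -> polytime (fun z => xors (s z) (t z)).
Proof.
move=> Ps Pt; apply: (@eq_polytime _ _ _ _ (fun z =>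
   [seq nth false (s z) i (+) nth false (t z) i | i <- iota 0 (size (s z))]));
  last by polytime.
move=> z; apply: (@eq_from_nth _ false); first by rewrite size_map size_iota size_xors.
rewrite size_map size_iota => i is_; rewrite (nth_map 0) ?size_iota // nth_iota // add0n.
elim: (s z) (t z) i is_ => [|a s' IH] [|b t'] [|i] //= is_;
  rewrite ?addbF ?nth_nil ?addbF //; exact: IH.
Qed.

Lemma polytime_reduce X {eX : encoding X} (p c : X -> seq bool) :
  polytime p -> polytime c -> polytime (fun z => reduce (p z) (c z)).
Proof.
move=> Pp Pc; apply: (@polytime_if _ _ _ _ (fun z => head false (c z))
  (fun z => behead (xors (c z) (p z))) (fun z => behead (c z))); polytime.
exact: polytime_xors.
Qed.

Lemma polytime_elim_step : polytime elim_step.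
Proof.
have Pp : polytime (fun z : bool * (seq (seq bool) * seq bool) => pivot z.2.1).
  by rewrite /pivot; polytime.
rewrite /elim_step; polytime; last by apply: polytime_reduce; polytime.
by apply: (@polytime_reduce _ _ (fun z : bool * (seq (seq bool) * seq bool) * seq bool =>
  pivot z.1.2.1) snd); polytime; apply: (polytime_comp (f := fst) Pp); polytime.
Qed.

Lemma polytime_eliminate X {eX : encoding X} (k : X -> nat) (cs : X -> seq (seq bool))
    (t : X -> seq bool) : polytime k -> polytime cs -> polytime t ->
  polytime (fun z => eliminate (k z) (cs z) (t z)).
Proof.
move=> Pk Pcs Pt; have [ec Hc] := polytime_wt Pcs; have [et Ht] := polytime_wt Pt.
apply: (@polytime_iter _ _ _ _ (fun _ => elim_step) (fun z => (true, (cs z, t z))) k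
  (fun n => 6 + (3 + (3 + 6 * n ^ ec) * n ^ ec) + (3 + 6 * n ^ et))).
- by polytime.
- by polytime.
- by apply: (polytime_comp (f := snd) polytime_elim_step); polytime.
- by poly_bound.
move=> z j _; set Wc := _ ^ ec; set Wt := _ ^ et.
(* Vectors only shrink and the number of columns is constant, so the invariant is about sizes;
   weights are recovered from them at the end. *)
have size_reduce p c : size (reduce p c) <= size c.
  by rewrite /reduce; case: ifP => _; rewrite size_behead ?size_xors; lia.
suff [cW cW' tW] : [/\ size (iter j elim_step (true, (cs z, t z))).2.1 <= Wc,
    all (fun c => size c <= Wc) (iter j elim_step (true, (cs z, t z))).2.1 &
    size (iter j elim_step (true, (cs z, t z))).2.2 <= Wt].
  move: (iter _ _ _) cW cW' tW => [b [cs' t']] /= cW cW' tW; rewrite !wt_pair /=.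
  rewrite -addnA leq_add ?wt_bool // leq_add //.
    apply: (@leq_trans (3 + (3 + 6 * Wc) * size cs')).
      apply: wt_seq_le; apply: sub_all cW' => c cc; apply: leq_trans (wt_bits_le _) _; lia.
    by rewrite leq_add2l leq_mul2l cW orbT.
  by apply: leq_trans (wt_bits_le _) _; lia.
elim: j => [|j [IH1 IH2 IH3]].
  split=> /=.
  - by apply: leq_trans (Hc z); exact: size_wt.
  - apply/allP => c ccs; apply: leq_trans (Hc z).
    apply: (@leq_trans (wt c)); first by exact: size_wt.
    elim: (cs z) ccs => // c' l IH; rewrite in_cons wt_cons => /orP[/eqP <-|/IH H].
      exact: leq_addr.
    exact: leq_trans H (leq_addl _ _).
  - by apply: leq_trans (Ht z); exact: size_wt.
rewrite iterS; move: (iter j _ _) IH1 IH2 IH3 => [b [cs' t']] /= IH1 IH2 IH3.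
split; first by rewrite size_map.
  by rewrite all_map; apply: sub_all IH2 => c /= ; apply: leq_trans.
exact: leq_trans (size_reduce _ _) IH3.
Qed.

Lemma polytime_unit_bits X {eX : encoding X} (n i : X -> nat) :
  polytime n -> polytime i -> polytime (fun z => unit_bits (n z) (i z)).
Proof. by move=> Pn Pi; rewrite /unit_bits; polytime. Qed.

Lemma polytime_stuck_bits X {eX : encoding X} (f : X -> seq (option bool)) :
  polytime f -> polytime (fun z => stuck_bits (f z)).
Proof. by move=> Pf; rewrite /stuck_bits; polytime. Qed.

Lemma polytime_columns X {eX : encoding X} (C k : X -> nat)
    (defects : X -> seq (option bool)) (r : X -> seq bool) :
  polytime C -> polytime k -> polytime defects -> polytime r ->
  polytime (fun z => columns (C z) (k z) (defects z) (r z)).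
Proof.
move=> PC Pk Pd Pr; rewrite /columns /free_cell; polytime.
  apply: (@polytime_decode _ _ (fun z : X * nat => C z.1) (fun z => k z.1)
    (fun z => r z.1)); polytime.
  by apply: (@polytime_unit_bits _ _ (fun z : X * nat => size (defects z.1)) snd); polytime.
by apply: (@polytime_unit_bits _ _ (fun z : X * nat => size (defects z.1)) snd); polytime.
Qed.

Lemma polytime_target X {eX : encoding X} (C : X -> nat)
    (defects : X -> seq (option bool)) (y r : X -> seq bool) :
  polytime C -> polytime defects -> polytime y -> polytime r ->
  polytime (fun z => target (C z) (defects z) (y z) (r z)).
Proof.
move=> PC Pd Py Pr; have Ps := polytime_stuck_bits Pd; rewrite /target; polytime => //.
by apply: polytime_xors => //; apply: polytime_decode => //; polytime.
Qed.

Lemma polytime_attempt X {eX : encoding X} (C : X -> nat)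
    (defects : X -> seq (option bool)) (y r : X -> seq bool) :
  polytime C -> polytime defects -> polytime y -> polytime r ->
  polytime (fun z => attempt (C z) (defects z) (y z) (r z)).
Proof.
move=> PC Pd Py Pr; apply: polytime_eliminate; first by polytime.
  by apply: polytime_columns => //; polytime.
exact: polytime_target.
Qed.

(** The coin loop pushes each fresh bit in front of a list, so the seed arrives reversed and [rev]
    restores the drawing order. A successful result is encoded exactly as [memory_content]
    requires. *)
Definition encode_attempt (z : nat * (seq (option bool) * seq bool) * seq bool) :
    option (seq bool * seq bool) :=
  let t := attempt z.1.1 z.1.2.1 z.1.2.2 (rev z.2) in
  if t.1 then Some (t.2.2, rev z.2) else None.

Lemma polytime_encode_attempt : polytime encode_attempt.
Proof.
have Pt : polytime (fun z : nat * (seq (option bool) * seq bool) * seq bool =>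
    attempt z.1.1 z.1.2.1 z.1.2.2 (rev z.2)) by apply: polytime_attempt; polytime.
apply: (@polytime_if _ _ _ _ (fun z : nat * (seq (option bool) * seq bool) * seq bool =>
  (attempt z.1.1 z.1.2.1 z.1.2.2 (rev z.2)).1)); [|polytime|polytime].
exact: polytime_fst.
Qed.

Definition decode_input (z : nat * (seq bool * seq bool * nat)) : seq bool :=
  decode z.1 z.2.1.2 z.2.1.1 z.2.2.

Lemma polytime_decode_input : polytime decode_input.
Proof. by apply: polytime_decode; polytime. Qed.

Lemma polytime_seed_length_input :
  polytime (fun z : nat * (seq (option bool) * seq bool) =>
    seed_length z.1 (size z.2.1)).
Proof. by apply: polytime_seed_length; polytime. Qed.

End Scheme.

(** * Gaussian elimination and the decoder *)

Section Elimination.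

Local Open Scope nat_scope.

Lemma xors_cat s s' t t' : size s = size s' ->
  xors (s ++ t) (s' ++ t') = xors s s' ++ xors t t'.
Proof. by elim: s s' => [|a s IH] [|a' s'] //= [ss']; rewrite IH. Qed.

Lemma xors_nseq i : xors (nseq i false) (nseq i false) = nseq i false.
Proof. by elim: i => //= i ->. Qed.

Lemma behead_xors s t : size s = size t -> behead (xors s t) = xors (behead s) (behead t).
Proof. by case: s t => [|a s] [|b t]. Qed.

Lemma pivot_mem cs : head false (pivot cs) -> pivot cs \in cs.
Proof.
rewrite /pivot; case E: [seq c <- cs | head false c] => [//|p l] _ /=.
have : p \in [seq c <- cs | head false c] by rewrite E mem_head.
by rewrite mem_filter => /andP[].
Qed.

Lemma no_pivot cs c : head false (pivot cs) = false -> c \in cs -> head false c = false.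
Proof.
move=> Hp ccs; apply: contraFF Hp => hc; rewrite /pivot.
have : c \in [seq c <- cs | head false c] by rewrite mem_filter hc.
have : all (head false) [seq c <- cs | head false c] by apply: filter_all.
by case: [seq c <- cs | head false c] => //= p l /andP[].
Qed.

(** The initial flag enters only by conjunction, so the first round can be peeled off in the
    induction of [eliminate_complete]. *)
Lemma eliminate_step k b cs t :
  iter k elim_step (b, (cs, t)) =
    (b && (eliminate k cs t).1, (eliminate k cs t).2).
Proof.
elim: k => [|k IHk]; first by rewrite /eliminate /= andbT.
by rewrite /eliminate !iterS -/(eliminate k cs t) IHk /elim_step /= andbA.
Qed.

Section Sound.

Variables (Pc Pt : seq bool -> Prop) (N : nat).
Hypothesis Pc_size : forall F, Pc F -> size F = N.
Hypothesis Pt_size : forall F, Pt F -> size F = N.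
Hypothesis Pc_xors : forall F G, Pc F -> Pc G -> Pc (xors F G).
Hypothesis Pt_xors : forall F G, Pt F -> Pc G -> Pt (xors F G).

(** [Pc] stands for a linear space and [Pt] for a coset of it; [P] is either of them. A truncated
    vector is brought back to length [N] by the zeros that the elimination has produced. *)
Lemma reduce_sound (P : seq bool -> Prop) i p c :
  (forall F, P F -> size F = N) -> (forall F G, P F -> Pc G -> P (xors F G)) ->
  i < N -> (head false p -> Pc (nseq i false ++ p)) ->
  (head false c -> head false p) ->
  P (nseq i false ++ c) -> P (nseq i.+1 false ++ reduce p c).
Proof.
move=> P_size P_xors iN Pp cp PF; have := P_size _ PF; rewrite size_cat size_nseq.
case: c cp PF => [|a c] cp PF; first by rewrite /= addn0 => iE; move: iN; rewrite iE ltnn.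
move=> _; rewrite -[i.+1]addn1 nseqD -catA /=.
case: a cp PF => cp PF; rewrite /reduce //=.
have {}cp := cp isT; have {}Pp := Pp cp; case: p cp Pp => [//|b p] /= -> Pp.
have := P_xors _ _ PF Pp.
by rewrite xors_cat ?size_nseq // xors_nseq.
Qed.

Lemma eliminate_sound k cs t : k <= N ->
  {in cs, forall c, Pc c} -> Pt t -> (eliminate k cs t).1 ->
  Pt (nseq k false ++ (eliminate k cs t).2.2).
Proof.
move=> kN Pcs Ptt.
suff : (eliminate k cs t).1 ->
  {in (eliminate k cs t).2.1, forall c, Pc (nseq k false ++ c)} /\
  Pt (nseq k false ++ (eliminate k cs t).2.2) by move=> H /H[].
elim: k kN => [//|k IHk] kN; rewrite /eliminate iterS -/(eliminate k cs t).
move: (eliminate k cs t) (IHk (ltnW kN)) => [b [cs' t']] /= IH.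
case/andP=> /IH [IHc IHt] Hp; split.
  move=> c /mapP[c' c'cs ->]; apply: reduce_sound (IHc _ c'cs) => //.
    by move=> /pivot_mem /IHc.
  by apply: contraTT => /negbTE /no_pivot ->.
apply: reduce_sound IHt => //; first by move=> /pivot_mem /IHc.
by move=> ht; move: Hp; rewrite ht orbF.
Qed.

End Sound.

(** Coordinates of [c] beyond the size of [u] are ignored, so a dual vector of length [k] sees only
    the decoder image and not the preimage carried behind it. *)
Fixpoint dot (u c : seq bool) : bool :=
  if u is a :: u' then (a && head false c) (+) dot u' (behead c) else false.

Lemma dotE u c : dot u c = \big[addb/false]_(0 <= i < size u) (nth false u i && nth false c i).
Proof.
elim: u c => [|a u IHu] c /=; first by rewrite big_geq.
rewrite big_nat_recl // -nth0 IHu; congr addb.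
by apply: eq_bigr => i _; rewrite nth_behead.
Qed.

Lemma dot_xors u s t : size s = size t -> dot u (xors s t) = dot u s (+) dot u t.
Proof.
move=> st; rewrite !dotE -big_split; apply: eq_bigr => i _ /=.
by rewrite nth_xors ?st // andb_addr.
Qed.

Lemma dot_nseq k c : dot (nseq k false) c = false.
Proof. by elim: k c => //= k IHk c. Qed.

(** Fredholm alternative: an unsolvable system has a dual vector that kills all columns but not the
    target. It is built backwards along the elimination. *)
Lemma eliminate_complete k cs t :
  {in cs, forall c, size c = size t} -> ~~ (eliminate k cs t).1 ->
  exists u, [/\ size u = k, {in cs, forall c, dot u c = false} & dot u t].
Proof.
elim: k cs t => [//|k IHk] cs t cst.
rewrite /eliminate iterSr eliminate_step /= negb_and.
case Hp: (head false (pivot cs)) => /=; last first.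
  have Hc := no_pivot Hp.
  case Ht: (head false t) => /=.
    (* All columns start with 0 and the target with 1, so the first coordinate separates them. *)
    move=> _; exists (true :: nseq k false); rewrite /= size_nseq; split=> //.
      by move=> c /Hc Hc0; rewrite /= dot_nseq Hc0.
    by rewrite dot_nseq Ht.
  case/IHk => [c /mapP[c' c'cs ->]|u [uk uc ut]].
    by rewrite /reduce Hc // Ht !size_behead cst.
  exists (false :: u); rewrite /= uk; split=> //.
    by move=> c ccs; have := uc _ (map_f _ ccs); rewrite /reduce Hc.
  by move: ut; rewrite /reduce Ht.
set p := pivot cs in Hp *; have pcs : p \in cs by exact: pivot_mem.
have size_reduce c : size (reduce p c) = (size c).-1.
  by rewrite /reduce; case: ifP => _; rewrite size_behead ?size_xors.
case/IHk => [c /mapP[c' c'cs ->]|u [uk uc ut]]; first by rewrite !size_reduce cst.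
(* The leading coordinate [dot u (behead p)] makes the extended vector orthogonal to the pivot, so
   adding the pivot to [c] does not change the product. *)
have dotE' c : size c = size t ->
    dot (dot u (behead p) :: u) c = dot u (reduce p c).
  move=> ct; rewrite /= /reduce; case: ifP => _; last by rewrite andbF.
  have ec : size c = size p by rewrite ct cst.
  by rewrite behead_xors // dot_xors ?size_behead ?ec // andbT addbC.
exists (dot u (behead p) :: u); split; first by rewrite /= uk.
  by move=> c ccs; rewrite dotE' ?cst // uc // map_f.
by rewrite dotE'.
Qed.

End Elimination.

(** * Linearity of the decoder and soundness of a successful elimination *)

Section DecodeLinear.

Local Open Scope nat_scope.

Lemma size_decode C r x k : size (decode C r x k) = k.
Proof. by rewrite size_map size_iota. Qed.

Lemma nth_decode C r x k i : i < k -> nth false (decode C r x k) i =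
  decode_bit (log_width C (size x)) (width C (size x)) (layers C (size x)) r x i.
Proof. by move=> ik; rewrite (nth_map 0) ?size_iota // nth_iota. Qed.

Lemma decode_bitE m M b r x i : decode_bit m M b r x i =
  \big[addb/false]_(0 <= j < b) (nth false r (j * (m + b) + m + i %/ M) &&
     nth false x (j * M + (i %% M + rotation m M r (j * (m + b))) %% M)).
Proof.
have foldl_addb (F : nat -> bool) a l :
    foldl (fun acc j => acc (+) F j) a l = a (+) \big[addb/false]_(j <- l) F j.
  by elim: l a => [|j l IH] a /=; rewrite ?big_nil ?addbF // IH big_cons addbA.
by rewrite /decode_bit foldl_addb /index_iota subn0.
Qed.

Lemma decode_bit_xors m M b r x x' i : size x = size x' ->
  decode_bit m M b r (xors x x') i = decode_bit m M b r x i (+) decode_bit m M b r x' i.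
Proof.
move=> xx'; rewrite !decode_bitE -big_split; apply: eq_bigr => j _ /=.
by rewrite nth_xors ?xx' // andb_addr.
Qed.

Lemma eq_bits (s t : seq bool) : size s = size t ->
  (forall i, i < size s -> nth false s i = nth false t i) -> s = t.
Proof. exact: eq_from_nth. Qed.

Lemma decode_xors C r x x' k : size x = size x' ->
  decode C r (xors x x') k = xors (decode C r x k) (decode C r x' k).
Proof.
move=> xx'; apply: eq_bits; rewrite ?size_xors ?size_decode // => i ik.
rewrite nth_xors ?size_decode // !nth_decode // size_xors -xx'.
exact: decode_bit_xors.
Qed.

Lemma xorsA s t u : size s = size t -> size t = size u ->
  xors (xors s t) u = xors s (xors t u).
Proof.
move=> st tu; apply: eq_bits; rewrite ?size_xors // => i _.
by rewrite !nth_xors ?size_xors ?st ?tu // addbA.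
Qed.

Lemma xors_eq0 s t : size s = size t -> xors s t = nseq (size s) false -> s = t.
Proof.
by elim: s t => [|a s IH] [|b t] //= [st] [ab /(IH _ st) <-]; case: a b ab => [] [].
Qed.

Lemma size_unit_bits n i : size (unit_bits n i) = n.
Proof. by rewrite size_map size_iota. Qed.

Lemma nth_unit_bits n i p : i < n -> nth false (unit_bits n i) p = (p == i).
Proof.
move=> i_n; case: (ltnP p n) => pn.
  by rewrite (nth_map 0) ?size_iota // nth_iota.
by rewrite nth_default ?size_unit_bits // gtn_eqF // (leq_trans i_n).
Qed.

(** The elimination is followed on vectors paired with preimages: [Pc] collects the images of
    contents that vanish on the stuck cells, [Pt] the remaining message next to a content that
    respects the defects. Once the first [k] coordinates are 0, this content decodes to [y]. *)
Lemma attempt_sound C defects y r : (attempt C defects y r).1 ->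
  [/\ size (attempt C defects y r).2.2 = size defects,
    forall i b, nth None defects i = Some b ->
      nth false (attempt C defects y r).2.2 i = b &
    decode C r (attempt C defects y r).2.2 (size y) = y].
Proof.
set n := size defects; set k := size y.
pose Pc F := exists e, [/\ size e = n,
  forall i, isSome (nth None defects i) -> nth false e i = false &
  F = decode C r e k ++ e].
pose Pt F := exists x, [/\ size x = n,
  forall i b, nth None defects i = Some b -> nth false x i = b &
  F = xors y (decode C r x k) ++ x].
rewrite /attempt; set cs := columns _ _ _ _; set t := target _ _ _ _ => ok.
have [|||||||x [xn xa]] := @eliminate_sound Pc Pt (k + n) _ _ _ _ k cs t _ _ _ ok.
- by move=> _ [e [en _ ->]]; rewrite size_cat size_decode en.
- by move=> _ [x [xn _ ->]]; rewrite size_cat size_xors xn.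
- move=> _ _ [e [en ez ->]] [e' [en' ez' ->]]; exists (xors e e').
  rewrite size_xors xors_cat ?size_decode // decode_xors ?en //; split=> // i Hi.
  by rewrite nth_xors ?en ?en' // ez // ez'.
- move=> _ _ [x [xn xa ->]] [e [en ez ->]]; exists (xors x e).
  rewrite size_xors xors_cat ?size_xors ?size_decode // decode_xors ?xn //.
  split=> //; last by rewrite xorsA ?size_decode.
  by move=> i b Hi; rewrite nth_xors ?en ?xn // (xa _ _ Hi) ez ?addbF // Hi.
- exact: leq_addr.
- move=> _ /mapP[i + ->]; rewrite mem_filter mem_iota /= add0n => /andP[fi i_n].
  exists (unit_bits n i); rewrite size_unit_bits; split=> // j Hj.
  rewrite nth_unit_bits //; apply: contraTF Hj => /eqP ->; exact: fi.
- exists (stuck_bits defects); rewrite size_map; split=> // i b Hi.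
  case: (ltnP i n) => i_n; last by rewrite nth_default in Hi.
  by rewrite (nth_map None) // Hi.
move/eqP; rewrite eqseq_cat ?size_nseq ?size_xors // => /andP[/eqP Ey /eqP Ex].
rewrite Ex; split=> //; symmetry.
by apply: xors_eq0; rewrite ?size_decode.
Qed.

End DecodeLinear.

(** * Certificates of failure *)

Section Certificate.

Local Open Scope nat_scope.

Lemma widthE C n : width C n = 2 ^ log_width C n.
Proof.
rewrite /width /log_width /params; elim: {1 3}n => // j IHj.
rewrite iterS /params_step; case: ifP => //= _.
by rewrite expnS IHj mulnC.
Qed.

Lemma width_gt0 C n : 0 < width C n.
Proof. by rewrite widthE expn_gt0. Qed.

Lemma divmod_inj M t v t' v' : v < M -> v' < M -> t * M + v = t' * M + v' -> t = t' /\ v = v'.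
Proof.
move=> vM vM' E; have M0 : 0 < M by case: (M) vM.
have := congr1 (divn^~ M) E; have := congr1 (modn^~ M) E.
by rewrite /= !modnMDl !divnMDl // !divn_small // !addn0 !modn_small.
Qed.

Lemma modn_addr_inj M v w p : v < M -> w < M -> (v + p) %% M = (w + p) %% M -> v = w.
Proof.
by move=> vM wM /eqP; rewrite eqn_modDr !modn_small // => /eqP.
Qed.

Lemma big_nat_divmod T (idx : T) (op : Monoid.law idx) K M (F : nat -> T) :
  \big[op/idx]_(0 <= i < K * M) F i =
  \big[op/idx]_(0 <= t < K) \big[op/idx]_(0 <= v < M) F (t * M + v).
Proof.
elim: K => [|K IHK]; first by rewrite !big_geq.
rewrite big_nat_recr //= -IHK mulSn addnC (big_cat_nat (n := K * M)) ?leq_addr //=.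
congr (op _ _); rewrite -{1}[K * M]add0n big_addn addKn.
by apply: eq_bigr => v _; rewrite addnC.
Qed.

(** A cell of layer [j] at rotated position [v] influences only the outputs congruent to [v] modulo
    [M], with the [j]-th matrix column as coefficients. Hence the dual vector may be restricted to
    the residue class of one of its nonzero entries. *)
Lemma attempt_certificate C defects y r : ~~ (attempt C defects y r).1 ->
  let n := size defects in let m := log_width C n in let M := width C n in
  let b := layers C n in
  exists v u, [/\ v < M, size u = (size y %/ M).+1, true \in u &
    forall j, j < b ->
      j * M + (v + rotation m M r (j * (m + b))) %% M < n ->
      free_cell defects (j * M + (v + rotation m M r (j * (m + b))) %% M) ->
      dot u (drop (j * (m + b) + m) r) = false].
Proof.
move=> fail n m M b; have M0 : 0 < M by exact: width_gt0.
set k := size y; set K := (k %/ M).+1.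
have [|U [Uk Uc Ut]] := eliminate_complete _ fail.
  move=> c /mapP[i _ ->].
  by rewrite !size_cat size_decode size_unit_bits size_xors size_map.
rewrite -/k in Uk Uc.
have [i0 i0k Ui0] : exists2 i, i < k & nth false U i.
  have UT : true \in U.
    apply: contraTT Ut => UT; have /all_pred1P -> : all (pred1 false) U.
      by apply/allP => -[] // /(negP UT).
    by rewrite dot_nseq.
  by exists (index true U); rewrite ?nth_index // -Uk index_mem.
set v := i0 %% M; have vM : v < M by rewrite ltn_mod.
(* [K] counts a possibly incomplete last row of outputs; entries of [U] past [k] read the default
   [false]. *)
pose u := [seq nth false U (t * M + v) | t <- iota 0 K].
have size_u : size u = K by rewrite size_map size_iota.
have nth_u t : t < K -> nth false u t = nth false U (t * M + v).
  by move=> tK; rewrite (nth_map 0) ?size_iota // nth_iota.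
exists v, u; split=> //.
  apply/mapP; exists (i0 %/ M); last by rewrite -divn_eq Ui0.
  by rewrite mem_iota /= add0n ltnS leq_div2r // ltnW.
move=> j jb; set l := j * M + _ => ln fl.
transitivity (dot U (decode C r (unit_bits n l) k ++ unit_bits n l)); last first.
  by apply: Uc; apply: map_f; rewrite mem_filter fl mem_iota.
rewrite !dotE Uk size_u.
pose F i := nth false U i && (nth false r (j * (m + b) + m + i %/ M) && (i %% M == v)).
have KM : k <= K * M by rewrite {1}(divn_eq k M) /K mulSn addnC leq_add2r ltnW // ltn_mod.
transitivity (\big[addb/false]_(0 <= i < k) F i); last first.
  apply: eq_big_nat => i /= ik; rewrite nth_cat size_decode ik nth_decode //.
  rewrite size_unit_bits -/m -/M -/b /F; congr andb.
  (* The unit vector of cell [l] meets layer [j] only, since quotient and remainder by [M] determine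
     layer and position. *)
  rewrite decode_bitE (bigD1_seq j) ?iota_uniq //=; last by rewrite mem_index_iota jb.
  rewrite big1 ?addbF => [|j' j'j].
    rewrite nth_unit_bits // eqn_add2l; congr andb.
    apply/eqP/eqP => [->//|]; apply: modn_addr_inj => //; exact: ltn_pmod.
  rewrite nth_unit_bits //; case: eqP => [E|]; last by rewrite andbF.
  have [] := divmod_inj (ltn_pmod _ M0) (ltn_pmod _ M0) E.
  by move=> jj'; rewrite jj' eqxx in j'j.
transitivity (\big[addb/false]_(0 <= i < K * M) F i); last first.
  rewrite (big_cat_nat (n := k)) //= [X in _ (+) X]big1_seq ?addbF // => i /=.
  by rewrite mem_index_iota => /andP[ki _]; rewrite /F nth_default ?Uk.
rewrite big_nat_divmod; apply: eq_big_nat => t /= tK.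
rewrite (bigD1_seq v) ?iota_uniq //=; last by rewrite mem_index_iota vM.
rewrite big1_seq ?addbF => [|w].
  rewrite /F modnMDl modn_small // eqxx andbT divnMDl // (divn_small vM) addn0.
  by rewrite nth_u // nth_drop.
rewrite mem_index_iota /F => /andP[wv /andP[_ wM]].
by rewrite modnMDl modn_small // (negbTE wv) !andbF.
Qed.

End Certificate.

(** * Probability of failure of a random seed *)

Section Average.

Context {R : realType}.
Local Open Scope ring_scope.

(** The uniform mean over bit strings of length [d]. Recursion on the first bit makes independence
    of consecutive parts an easy induction, without counting tuples. *)
Fixpoint avg (d : nat) (F : seq bool -> R) : R :=
  if d is d'.+1 then
    (avg d' (fun w => F (false :: w)) + avg d' (fun w => F (true :: w))) / 2
  else F [::].

Lemma ler_avg d (F G : seq bool -> R) :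
  (forall w, size w = d -> F w <= G w) -> avg d F <= avg d G.
Proof.
elim: d F G => [|d IH] F G FG /=; first exact: FG.
by rewrite ler_pM2r // lerD // IH // => w wd; rewrite FG //= wd.
Qed.

Lemma eq_avg d (F G : seq bool -> R) :
  (forall w, size w = d -> F w = G w) -> avg d F = avg d G.
Proof. by move=> FG; apply: le_anti; rewrite !ler_avg // => w /FG ->. Qed.

Lemma avg_const d (c : R) : avg d (fun=> c) = c.
Proof. by elim: d => //= d ->; field. Qed.

Lemma avgD d (F G : seq bool -> R) : avg d (fun w => F w + G w) = avg d F + avg d G.
Proof. by elim: d F G => //= d IH F G; rewrite !IH; field. Qed.

Lemma avgZ d c (F : seq bool -> R) : avg d (fun w => c * F w) = c * avg d F.
Proof. by elim: d F => //= d IH F; rewrite !IH; field. Qed.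

Lemma avgB d (F G : seq bool -> R) : avg d (fun w => F w - G w) = avg d F - avg d G.
Proof.
rewrite (eq_avg (G := fun w => F w + -1 * G w)) => [|w _]; last by ring.
by rewrite avgD avgZ; ring.
Qed.

Lemma avg_sum d n (F : nat -> seq bool -> R) :
  avg d (fun w => \sum_(0 <= v < n) F v w) = \sum_(0 <= v < n) avg d (F v).
Proof.
elim: n => [|n IH].
  by rewrite big_geq // (eq_avg (G := fun=> 0)) ?avg_const // => w _; rewrite big_geq.
rewrite big_nat_recr //= -IH -avgD; apply: eq_avg => w _; by rewrite big_nat_recr.
Qed.

Lemma avg_ge0 d (F : seq bool -> R) : (forall w, 0 <= F w) -> 0 <= avg d F.
Proof. by move=> F0; rewrite -(avg_const d 0) ler_avg. Qed.

(** A single string has probability [2 ^- size w]. This serves twice: to extract one certificate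
    from a mean over all [u], and to exclude a single wrong run. *)
Lemma avg_ge (F : seq bool -> R) w : (forall w, 0 <= F w) ->
  F w <= 2 ^+ size w * avg (size w) F.
Proof.
elim: w F => [|b w IH] F F0 /=; first by rewrite expr0 mul1r.
have -> (x : R) : 2 ^+ (size w).+1 * (x / 2) = 2 ^+ size w * x by rewrite exprS; field.
rewrite mulrDr; have Fb c : 0 <= 2 ^+ size w * avg (size w) (fun w => F (c :: w)).
  by rewrite mulr_ge0 ?exprn_ge0 // avg_ge0.
have := IH (fun w => F (b :: w)) (fun=> F0 _).
by case: b => H; rewrite (le_trans H) // ?lerDl ?lerDr.
Qed.

Lemma avg_add d1 d2 (F : seq bool -> R) :
  avg (d1 + d2) F = avg d1 (fun w1 => avg d2 (fun w2 => F (w1 ++ w2))).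
Proof. by elim: d1 F => //= d1 IH F; rewrite !IH. Qed.

Lemma avg_swap d1 d2 (F : seq bool -> seq bool -> R) :
  avg d1 (fun w1 => avg d2 (fun w2 => F w1 w2)) =
  avg d2 (fun w2 => avg d1 (fun w1 => F w1 w2)).
Proof.
elim: d1 F => //= d1 IH F; rewrite !IH -avgD mulrC -avgZ.
by apply: eq_avg => w _; rewrite mulrC.
Qed.

(** Independence of disjoint blocks; this is why each layer owns a block of the seed. *)
Lemma avg_blocks L b (F : nat -> seq bool -> R) :
  avg (b * L) (fun r => \prod_(0 <= j < b) F j (take L (drop (j * L) r))) =
  \prod_(0 <= j < b) avg L (F j).
Proof.
elim: b F => [|b IH] F; first by rewrite mul0n /= !big_geq.
rewrite mulSn avg_add big_nat_recl //= -IH -[RHS]mulrC -avgZ.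
apply: eq_avg => w wL; rewrite mulrC -avgZ; apply: eq_avg => r _.
rewrite big_nat_recl // mul0n drop0 -wL take_size_cat //; congr (_ * _).
by apply: eq_bigr => j _; rewrite mulSn drop_cat ltnNge leq_addr /= addKn.
Qed.

Definition bits_val (a : nat) (w : seq bool) : nat :=
  foldl (fun v (b : bool) => v * 2 + b)%N a w.

Lemma avg_bits_val m a (G : nat -> R) :
  avg m (fun w => G (bits_val a w)) =
  (\sum_(0 <= i < 2 ^ m) G (a * 2 ^ m + i)%N) / (2 ^ m)%:R.
Proof.
elim: m a => [|m IH] a; first by rewrite /= big_nat1 muln1 addn0 divr1.
have pow2 : (2 ^ m.+1 = 2 ^ m + 2 ^ m)%N by rewrite expnS mul2n addnn.
have -> : \sum_(0 <= i < 2 ^ m.+1) G (a * 2 ^ m.+1 + i)%N =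
    \sum_(0 <= i < 2 ^ m) G ((a * 2 + 0) * 2 ^ m + i)%N +
    \sum_(0 <= i < 2 ^ m) G ((a * 2 + 1) * 2 ^ m + i)%N.
  rewrite {1}pow2 (big_cat_nat (n := (2 ^ m)%N)) ?leq_addr //=; congr (_ + _).
    by apply: eq_bigr => i _; congr G; rewrite pow2; lia.
  rewrite -{1}[(2 ^ m)%N]add0n big_addn addnK.
  by apply: eq_bigr => i _; congr G; rewrite pow2; lia.
rewrite [LHS]/= !IH pow2 natrD; set q : R := (2 ^ m)%:R.
by rewrite -mulrDl -mulrA -invfM mulr_natr mulr2n.
Qed.

End Average.

(** * Chernoff bound and weighted count of certificates *)

Section Failure.

Context {R : realType}.
Local Open Scope ring_scope.

Lemma bits_val_lt a w : (bits_val a w < a.+1 * 2 ^ size w)%N.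
Proof.
elim: w a => [|b w IH] a /=; first by rewrite muln1.
apply: leq_trans (IH _) _; rewrite expnS mulnA leq_mul2r; apply/orP; right.
by case: b; lia.
Qed.

(** The reductions modulo [2 ^ m] can be postponed to the end, where they do nothing because an
    [m]-bit value is below [2 ^ m]. *)
Lemma rotation_bits_val m w1 w2 : size w1 = m ->
  rotation m (2 ^ m) (w1 ++ w2) 0 = bits_val 0 w1.
Proof.
move=> <-; rewrite /rotation prednK ?expn_gt0 //; set M := (2 ^ size w1)%N.
have foldl_mod (l : seq bool) v : foldl (fun v (b : bool) => (v * 2 + b) %% M)%N (v %% M)%N l
    = (bits_val v l %% M)%N.
  elim: l v => //= b l IH v; rewrite -IH; congr foldl.
  by rewrite -modnDml modnMml modnDml.
rewrite -[RHS](@modn_small _ M) -?foldl_mod ?mod0n; last first.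
  by have := bits_val_lt 0 w1; rewrite mul1n.
have foldl_map (F : nat -> bool -> nat) h (l : seq nat) v :
    foldl F v [seq h i | i <- l] = foldl (fun v i => F v (h i)) v l.
  by elim: l v => //= i l IH v.
have w1E : w1 = [seq nth false (w1 ++ w2) i | i <- iota 0 (size w1)].
  by rewrite map_nth_iota0 ?take_size_cat // size_cat leq_addr.
transitivity (foldl (fun v (b : bool) => (v * 2 + b) %% M)%N 0%N
  [seq nth false (w1 ++ w2) i | i <- iota 0 (size w1)]); last by rewrite -w1E.
by rewrite foldl_map.
Qed.

Lemma rotation_chunk m M L r o : (m <= L)%N ->
  rotation m M r o = rotation m M (take L (drop o r)) 0.
Proof.
move=> mL; rewrite /rotation; have : all (fun i => i < m)%N (iota 0 m).
  by apply/allP => i; rewrite mem_iota.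
have foldlE l v : all (fun i => i < m)%N l ->
    foldl (fun v i => (v * 2 + nth false r (o + i)) %% M.-1.+1)%N v l =
    foldl (fun v i => (v * 2 + nth false (take L (drop o r)) (0 + i)) %% M.-1.+1)%N v l.
  elim: l v => //= i l IH v /andP[im lm].
  by rewrite add0n nth_take ?nth_drop ?(leq_trans im) // IH.
exact: foldlE.
Qed.

Lemma dot_chunk u m b r o : (size u <= b)%N ->
  dot u (drop (o + m) r) = dot u (drop m (take (m + b) (drop o r))).
Proof.
move=> ub; rewrite !dotE; apply: eq_big_nat => i /= iu; congr andb.
rewrite !nth_drop nth_take ?nth_drop ?addnA //.
by rewrite ltn_add2l (leq_trans iu).
Qed.

Lemma avg_chunk m b (F : nat -> seq bool -> R) :
  avg (m + b) (fun w => F (rotation m (2 ^ m) w 0) (drop m w)) =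
  (\sum_(0 <= i < 2 ^ m) avg b (F i)) / (2 ^ m)%:R.
Proof.
rewrite avg_add -(avg_bits_val m 0 (fun i => avg b (F i))).
apply: eq_avg => w1 w1m; apply: eq_avg => w2 _.
by rewrite rotation_bits_val // drop_size_cat.
Qed.

Lemma sum_rotate M v (F : nat -> R) : (v < M)%N ->
  \sum_(0 <= i < M) F ((v + i) %% M)%N = \sum_(0 <= i < M) F i.
Proof.
move=> vM; rewrite (big_cat_nat (n := (M - v)%N)) ?leq_subr //=.
rewrite [RHS](big_cat_nat (n := v)) ?(ltnW vM) //= addrC; congr (_ + _).
  rewrite -{1}[(M - v)%N]add0n big_addn subKn ?(ltnW vM) //.
  apply: eq_big_nat => i /= iv; congr F.
  have -> : (v + (i + (M - v)) = M + i)%N by lia.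
  by rewrite modnDl modn_small // (ltn_trans iv).
rewrite -{3}[v]add0n big_addn; apply: eq_big_nat => i /= iM.
by rewrite addnC modn_small //; lia.
Qed.

(** At a true entry of [u], flipping the matching bit flips the product, so exactly half of the
    strings are orthogonal to [u]. *)
Lemma avg_dot u b : true \in u -> (size u <= b)%N ->
  avg b (fun g => (~~ dot u g)%:R) = 2^-1 :> R.
Proof.
elim: u b => //= a u IH [//|b]; rewrite in_cons ltnS => Hu ub /=.
case: a Hu => Hu /=; last by rewrite IH //; field.
rewrite -avgD (eq_avg (G := fun=> 1)); first by rewrite avg_const mul1r.
by move=> w _; case: (dot u w) => /=; ring.
Qed.

Section Bound.

Variables (C : nat) (defects : seq (option bool)) (y : seq bool).
Let n := size defects.
Let m := log_width C n.
Let M := width C n.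
Let b := layers C n.
Let K := (size y %/ M).+1.
Hypothesis Kb : (K <= b)%N.

Definition free_at (j i : nat) : bool :=
  (j * M + i < n)%N && free_cell defects (j * M + i).

Let X (v j : nat) (w : seq bool) : bool :=
  free_at j ((v + rotation m M w 0) %% M).

Let chunk (r : seq bool) (j : nat) : seq bool := take (m + b) (drop (j * (m + b)) r).

(** The factor 2 compensates the probability 1/2 of orthogonality, so that the mean is 1 for every
    rotation. *)
Let bad (u : seq bool) (v j : nat) (w : seq bool) : R :=
  if X v j w then 2 * (~~ dot u (drop m w))%:R else 1.

(** The generating-function factor [z ^ X] of a Chernoff bound for the lower tail. *)
Let light (z : R) (v j : nat) (w : seq bool) : R := if X v j w then z else 1.

(** The factor [2 ^+ K] turns the mean over [u] into a sum over all [u]. *)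
Let certificates (v : nat) (r : seq bool) : R :=
  2 ^+ K * avg K (fun u => (true \in u)%:R * \prod_(0 <= j < b) bad u v j (chunk r j)).

(** A rotated layer position [v] meets either at most [theta] free cells, or
    enough of them to make a certificate [u] unlikely. *)
Lemma failure_pointwise (z : R) theta r : 0 < z -> z <= 1 ->
  (~~ (attempt C defects y r).1)%:R <=
  \sum_(0 <= v < M) (z ^- theta * \prod_(0 <= j < b) light z v j (chunk r j) +
    2 ^- theta * certificates v r).
Proof.
move=> z0 z1.
have light_ge0 v : 0 <= z ^- theta * \prod_(0 <= j < b) light z v j (chunk r j).
  apply: mulr_ge0; first by rewrite invr_ge0 exprn_ge0 // ltW.
  rewrite prodr_ge0 // => j _.
  by rewrite /light; case: ifP => _; [exact: ltW | exact: ler01].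
have bad_ge0 u v : 0 <= \prod_(0 <= j < b) bad u v j (chunk r j).
  rewrite prodr_ge0 // => j _; rewrite /bad; case: ifP => _; last exact: ler01.
  by rewrite mulr_ge0 // ler0n.
have cert_ge0 v : 0 <= 2 ^- theta * certificates v r.
  rewrite mulr_ge0 ?invr_ge0 ?exprn_ge0 // mulr_ge0 ?exprn_ge0 // avg_ge0 // => u.
  by rewrite mulr_ge0 ?ler0n.
case ok: (attempt C defects y r).1 => /=.
  by rewrite sumr_ge0 // => v _; rewrite addr_ge0.
have [v [u [vM uK Tu Hu]]] := attempt_certificate (negbT ok).
rewrite (bigD1_seq v) ?iota_uniq //=; last by rewrite mem_index_iota vM.
apply: ler_wpDr; first by rewrite sumr_ge0 // => w _; rewrite addr_ge0.
pose f := (\sum_(0 <= j < b) X v j (chunk r j))%N.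
have prodX (a : R) : \prod_(0 <= j < b) (if X v j (chunk r j) then a else 1) = a ^+ f.
  rewrite -prodrXr; apply: eq_bigr => j _.
  by case: X => /=; rewrite ?expr1 ?expr0.
rewrite /light prodX.
(* If [f <= theta], the light term is [z ^+ f / z ^+ theta], at least 1 because [z <= 1]. Otherwise
   the certificate [u] has weight [2 ^+ f], which exceeds [2 ^+ theta]. *)
case: (leqP f theta) => f_theta.
  apply: ler_wpDr; first exact: cert_ge0.
  rewrite mulrC -[1]/(1%:R) ler_pdivlMr ?exprn_gt0 // mul1r.
  by rewrite ler_wiXn2l // ltW.
apply: ler_wpDl; first by have := light_ge0 v; rewrite /light prodX.
rewrite mulrC ler_pdivlMr ?exprn_gt0 // mul1r.
have := @avg_ge R (fun u => (true \in u)%:R * \prod_(0 <= j < b) bad u v j (chunk r j)) u.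
rewrite uK => H; apply: le_trans (H _); last by move=> w; rewrite mulr_ge0.
rewrite Tu mul1r.
have -> : \prod_(0 <= j < b) bad u v j (chunk r j) = 2 ^+ f.
  rewrite -prodX; apply: eq_big_nat => j /= jb; rewrite /bad.
  case Xj: (X v j (chunk r j)) => //.
  rewrite -dot_chunk ?uK // Hu ?mulr1 //.
  - by move: Xj; rewrite /X /free_at -rotation_chunk ?leq_addr // => /andP[].
  - by move: Xj; rewrite /X /free_at -rotation_chunk ?leq_addr // => /andP[].
by rewrite ler_eXn2l ?ltr1n // ltnW.
Qed.

Lemma sum_free_at :
  \sum_(0 <= j < b) \sum_(0 <= i < M) (free_at j i)%:R =
  (count (free_cell defects) (iota 0 n))%:R :> R.
Proof.
rewrite /free_at -(big_nat_divmod _ b M (fun i => ((i < n)%N && free_cell defects i)%:R)).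
have nbM : (n <= b * M)%N by rewrite ltnW // ltn_ceil // width_gt0.
rewrite (big_cat_nat (n := n)) //= [X in _ + X]big1_seq ?addr0 => [|i /=]; last first.
  by rewrite mem_index_iota => /andP[ni _]; rewrite ltnNge ni.
rewrite -sum1_count natr_sum [RHS]big_mkcond /index_iota subn0.
apply: eq_big_seq => i; rewrite mem_iota /= add0n => ->.
by case: free_cell.
Qed.

(** The shifted position is uniform in the layer, so [X v j] is a Bernoulli variable whose parameter
    is the density of free cells there, the same for every [v]. *)
Lemma avg_light (z : R) v j : (v < M)%N ->
  avg (m + b) (light z v j) =
  1 - (1 - z) * (\sum_(0 <= i < M) (free_at j i)%:R / M%:R).
Proof.
move=> vM; have M0 : M%:R != 0 :> R by rewrite pnatr_eq0 -lt0n width_gt0.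
rewrite -mulr_suml.
have := avg_chunk m b (fun i _ => if free_at j ((v + i) %% M) then z else 1).
rewrite -widthE -/M => E; rewrite /light /X [LHS]E.
have -> : \sum_(0 <= i < M) avg b (fun=> if free_at j ((v + i) %% M) then z else 1) =
   \sum_(0 <= i < M) (1 - (1 - z) * (free_at j i)%:R).
  rewrite -(sum_rotate (fun i => 1 - (1 - z) * (free_at j i)%:R) vM).
  apply: eq_bigr => i _; rewrite avg_const.
  by case: ifP => _; rewrite ?mulr1 ?mulr0 ?subr0 // subKr.
rewrite sumrB -mulr_sumr big_const_nat subn0 iter_addr_0.
by rewrite -[1 *+ _]/(M%:R); field.
Qed.

Lemma avg_bad u v j : (v < M)%N -> true \in u -> (size u <= b)%N ->
  avg (m + b) (bad u v j) = 1.
Proof.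
move=> vM Tu ub; have M0 : M%:R != 0 :> R by rewrite pnatr_eq0 -lt0n width_gt0.
have := avg_chunk m b (fun i g => if free_at j ((v + i) %% M) then 2 * (~~ dot u g)%:R else 1).
rewrite -widthE -/M => E; rewrite /bad /X [LHS]E.
rewrite (eq_bigr (fun=> 1)) => [|i _]; last first.
  case: (free_at _ _); last exact: avg_const.
  by rewrite (avgZ b 2 (fun g => (~~ dot u g)%:R)) avg_dot // divff.
by rewrite big_const_nat subn0 iter_addr_0 -[1 *+ _]/(M%:R) divff.
Qed.

(** With [z = expR (- eta)], the inequality [1 + x <= expR x] turns the product over the layers into
    the exponential of the summed densities. In the other term each of the at most [2 ^ K] vectors
    [u] has mean weight 1. *)
Lemma failure_bound (eta : R) theta : 0 <= eta ->
  avg (seed_length C n) (fun r => (~~ (attempt C defects y r).1)%:R) <=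
  M%:R * (expR (eta * theta%:R - (1 - expR (- eta)) *
      ((count (free_cell defects) (iota 0 n))%:R / M%:R)) + 2 ^+ K / 2 ^+ theta).
Proof.
move=> eta0; set z := expR (- eta).
have z0 : 0 < z by exact: expR_gt0.
have z1 : z <= 1 by rewrite /z -expR0 ler_expR oppr_le0.
apply: le_trans (ler_avg (fun r _ => failure_pointwise theta r z0 z1)) _.
rewrite avg_sum mulr_natl -[X in _ <= _ *+ X]subn0 -sumr_const_nat.
rewrite ler_sum_nat // => v /= vM; rewrite avgD !avgZ; apply: lerD.
  rewrite /seed_length -/m -/b avg_blocks expRD; apply: ler_pM.
  - by rewrite invr_ge0 exprn_ge0 // ltW.
  - rewrite prodr_ge0 // => j _; apply: avg_ge0 => w.
    by rewrite /light; case: ifP => _; [exact: ltW | exact: ler01].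
  - by rewrite /z expRN exprVn invrK expRM_natr.
  have -> : - ((1 - z) * ((count (free_cell defects) (iota 0 n))%:R / M%:R)) =
    \sum_(0 <= j < b) - ((1 - z) * (\sum_(0 <= i < M) (free_at j i)%:R / M%:R)).
    rewrite sumrN -mulr_sumr -sum_free_at mulr_suml; congr (- (_ * _)).
    by apply: eq_bigr => j _; rewrite mulr_suml.
  rewrite expR_sum; apply: ler_prod => j _; apply/andP; split.
    apply: avg_ge0 => w.
    by rewrite /light; case: ifP => _; [exact: ltW | exact: ler01].
  by rewrite avg_light // expR_ge1Dx.
rewrite mulrC ler_pM2r ?invr_gt0 ?exprn_gt0 //.
rewrite ler_piMr ?exprn_ge0 // avg_swap -[leRHS](avg_const K 1).
apply: ler_avg => u uK; rewrite avgZ.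
case Tu: (true \in u); last by rewrite mul0r.
rewrite mul1r /seed_length -/m -/b avg_blocks big1_seq // => j _.
by rewrite avg_bad // uK.
Qed.

End Bound.

End Failure.

(** * Size of the parameters *)

Section LayerCounts.

Local Open Scope nat_scope.

Lemma params_le C n : C.+1 * log_width C n * width C n <= n.
Proof.
rewrite /log_width /width /params; elim: {1 3}n => [|j IH]; first by rewrite /= muln0.
by rewrite iterS; move: (iter j _ _) IH => z Hz; rewrite /params_step; case: ifP.
Qed.

(** Once the doubling stops, the failed test is the claim. It does stop within [n] iterations:
    otherwise [log_width C n = n], and [params_le] would force [n * 2 ^ n <= n]. *)
Lemma params_gt C n : n < C.+1 * (log_width C n).+1 * (width C n * 2).
Proof.
case: (posnP n) => [->//|n0].
have [mn|//] : log_width C n = n \/ n < C.+1 * (log_width C n).+1 * (width C n * 2).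
  rewrite /log_width /width /params.
  suff H j : (iter j (params_step C n) (0, 1)).1 = j \/
    n < C.+1 * (iter j (params_step C n) (0, 1)).1.+1 *
      ((iter j (params_step C n) (0, 1)).2 * 2).
    exact: H.
  elim: j => [|j]; first by left.
  rewrite iterS; move: (iter j _ _) => z [zj|zn]; last first.
    by right; rewrite /params_step ifN // -ltnNge.
  by rewrite /params_step; case: ifP => [_|/negbT];
     [left; rewrite /= zj | rewrite -ltnNge; right].
have := params_le C n; rewrite widthE mn => H.
have := ltn_expl n (isT : 1 < 2); nia.
Qed.

Lemma log_width_gt0 C n : 2 * C.+1 <= n -> 0 < log_width C n.
Proof.
by move=> Cn; have := params_gt C n; rewrite widthE; case: (log_width C n) => //; lia.
Qed.

Lemma layers_ge C n : C.+1 * log_width C n <= n %/ width C n.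
Proof. by rewrite leq_divRL ?width_gt0 // params_le. Qed.

Lemma layers_le C n : layers C n <= 2 * C.+1 * (log_width C n).+1.
Proof.
rewrite /layers ltn_divLR ?width_gt0 //.
by apply: leq_trans (params_gt C n) _; rewrite leq_eqVlt; apply/orP; left; apply/eqP; lia.
Qed.

Lemma log_width_le C n : log_width C n <= n.
Proof.
apply: leq_trans (params_le C n); rewrite -mulnA -{1}[log_width C n]mul1n leq_mul //.
by rewrite leq_pmulr // width_gt0.
Qed.

Lemma seed_length_le C n : seed_length C n <= n.+1 * (n + n.+1).
Proof.
have bn : layers C n <= n.+1 by rewrite ltnS leq_div.
by rewrite leq_mul // leq_add // log_width_le.
Qed.

End LayerCounts.

(** * Numerical estimates *)

Section Numeric.

Context {R : realType}.
Local Open Scope ring_scope.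

Lemma expR_le2 : expR (- (2^-1)) * 2 >= 1 :> R.
Proof.
have := expR_ge1Dx (- (2^-1) : R); lra.
Qed.

Lemma expRN1_le : expR (-1) <= 2^-1 :> R.
Proof.
rewrite expRN lef_pV2 ?posrE ?expR_gt0 //.
by have := expR_ge1Dx (1 : R); lra.
Qed.

Lemma ln2_ge : 2^-1 <= ln 2 :> R.
Proof.
rewrite -ler_expR lnK ?posrE //.
have := expR_le2; rewrite expRN => H.
by rewrite -(ler_pM2l (_ : 0 < (expR 2^-1)^-1)) ?invr_gt0 ?expR_gt0 // mulVf //
  gt_eqF // expR_gt0.
Qed.

Lemma expRN_le (eta : R) : 0 <= eta -> eta - eta ^+ 2 <= 1 - expR (- eta).
Proof.
move=> eta0; rewrite expRN; have e1 := expR_ge1Dx eta.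
have : (expR eta)^-1 <= (1 + eta)^-1 by rewrite lef_pV2 ?posrE ?expR_gt0 //; lra.
suff : (1 + eta)^-1 <= 1 - eta + eta ^+ 2 by lra.
rewrite -[leLHS]mul1r ler_pdivrMr; last lra.
have -> : (1 - eta + eta ^+ 2) * (1 + eta) = 1 + eta ^+ 3 by ring.
by rewrite lerDl exprn_ge0.
Qed.

(** The seed is quadratic in the logarithm; the third factor is gained from [2 * ln n >= 1]. Since
    [ln 2 >= 1/2], one has [m.+1 <= 4 * ln n], whose square gives 16, and the spare factor 2 makes
    it 32. *)
Lemma seed_length_polylog C n : (2 * C.+1 <= n)%N ->
  (seed_length C n)%:R <= (64 * C.+1 * (2 * C.+1 + 1))%:R * ln (n%:R) ^+ 3 :> R.
Proof.
move=> Cn; set m := log_width C n; have m0 : (0 < m)%N by exact: log_width_gt0.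
have Mn : (2 ^ m <= n)%N.
  by rewrite -widthE; apply: leq_trans (params_le C n); rewrite leq_pmull // muln_gt0.
have n2 : 2 <= n%:R :> R by rewrite ler_nat; lia.
have lnn : 2^-1 <= ln n%:R :> R.
  by apply: le_trans ln2_ge _; rewrite ler_ln ?posrE //; lra.
have lnm : m%:R * 2^-1 <= ln n%:R :> R.
  apply: (@le_trans _ _ (ln (2 ^ m)%:R)).
    by rewrite natrX lnXn // -[ln _ *+ _]mulr_natl ler_wpM2l // ln2_ge.
  by rewrite ler_ln ?posrE ?ler_nat // ltr0n ?expn_gt0 //; lia.
have mln : m.+1%:R <= 4 * ln n%:R :> R by rewrite -natr1; lra.
have : (seed_length C n <= 2 * C.+1 * (2 * C.+1 + 1) * (m.+1 * m.+1))%N.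
  have := layers_le C n; rewrite -/m /seed_length -/m; move: (layers C n) => b Hb.
  by apply: leq_trans (leq_mul Hb (leq_add (leqnn m) Hb)) _; nia.
rewrite -(ler_nat R) => /le_trans; apply; rewrite natrM.
have -> : (64 * C.+1 * (2 * C.+1 + 1))%:R = (2 * C.+1 * (2 * C.+1 + 1))%:R * 32 :> R.
  by rewrite -natrM; congr _%:R; lia.
rewrite -mulrA ler_wpM2l // natrM.
apply: (@le_trans _ _ ((4 * ln n%:R) * (4 * ln n%:R))).
  by rewrite ler_pM.
move: lnn; set l := ln n%:R => lnn.
have -> : 4 * l * (4 * l) = 16 * l ^+ 2 by ring.
have -> : 32 * l ^+ 3 = 16 * l ^+ 2 * (2 * l) by ring.
by rewrite ler_peMr; [|rewrite mulr_ge0 // exprn_ge0|]; lra.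
Qed.

(** Here [phi] and [beta] are the numbers of free cells and of all cells per position, and [k1] the
    number of message rows. For [eta = delta / 4], the bound [1 - expR (- eta) >= eta - eta ^+ 2]
    leaves an exponent of at most [- 3/16 * delta ^+ 2 * beta + delta * (m + 3) / 4]; the constant
    60 brings it below [- 3 * m], and [3 * m >= m + 2]. *)
Lemma failure_numeric (delta phi beta k1 : R) (m : nat) : (0 < m)%N ->
  0 < delta -> delta < 1 -> 60 * m%:R <= delta ^+ 2 * beta ->
  k1 + delta * beta <= phi -> phi <= beta -> 0 <= phi ->
  expR (delta / 4 * (k1 + m%:R + 3) - (1 - expR (- (delta / 4))) * phi) <=
  2 ^- (m + 2).
Proof.
move=> m0 d0 d1 Hb Hk Hphi phi0.
have m1 : 1 <= m%:R :> R by rewrite ler1n.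
have He := expRN_le (ltW (divr_gt0 d0 (ltr0n _ 4))).
apply: (@le_trans _ _ (expR (- (3 * m)%:R))).
  rewrite ler_expR natrM.
  have H1 : (delta / 4 - (delta / 4) ^+ 2) * phi <= (1 - expR (- (delta / 4))) * phi.
    by rewrite ler_wpM2r.
  have H2 : delta / 4 * (k1 + delta * beta - phi) <= 0.
    by apply: mulr_ge0_le0; lra.
  have H3 : (delta / 4) ^+ 2 * (phi - beta) <= 0.
    by apply: mulr_ge0_le0; [rewrite exprn_ge0 // |]; lra.
  have H4 : delta * (m%:R + 3) <= m%:R + 3 by apply: ler_piMl; lra.
  move: H1 H2 H3 H4 Hb m1; rewrite !expr2; nra.
have -> : - (3 * m)%:R = -1 * (3 * m)%:R :> R by rewrite mulN1r.
rewrite expRM_natr.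
apply: (@le_trans _ _ (2^-1 ^+ (3 * m))).
  by rewrite lerXn2r ?nnegrE ?expR_ge0 ?invr_ge0 // expRN1_le.
by rewrite -exprVn ler_wiXn2l ?invr_ge0 // ?invf_le1 ?ler1n //; lia.
Qed.

Lemma failure_le_half (delta : R) C defects y :
  0 < delta -> delta < 1 -> 60 <= delta ^+ 2 * C.+1%:R ->
  (2 * C.+1 <= size defects)%N ->
  (size y)%:R + delta * (size defects)%:R <=
    (count (free_cell defects) (iota 0 (size defects)))%:R ->
  avg (seed_length C (size defects))
    (fun r => (~~ (attempt C defects y r).1)%:R) <= 2^-1 :> R.
Proof.
set n := size defects; set f := count _ _; set k := size y => d0 d1 Cd Cn Hf.
have fn : (f <= n)%N by rewrite -[X in (_ <= X)%N](size_iota 0 n) count_size.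
have kn : (k <= n)%N.
  apply: leq_trans fn; rewrite -(ler_nat R); apply: le_trans Hf.
  by rewrite lerDl mulr_ge0 // ltW.
set m := log_width C n; have m0 : (0 < m)%N by exact: log_width_gt0.
set M := width C n; have M0 : 0 < M%:R :> R by rewrite ltr0n width_gt0.
have div_le a : (a %/ M)%:R <= a%:R / M%:R :> R.
  by rewrite ler_pdivlMr // -natrM ler_nat leq_divM.
have Kb : ((k %/ M).+1 <= layers C n)%N by rewrite ltnS leq_div2r.
have e0 : 0 <= delta / 4 by rewrite divr_ge0 // ltW.
(* This [theta] makes [2 ^+ K / 2 ^+ theta] equal to [2 ^- (m + 2)]; two such terms at each of
   [2 ^ m] positions add up to 1/2. *)
apply: le_trans (failure_bound Kb ((k %/ M).+1 + m + 2) e0) _.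
have := @failure_numeric delta (f%:R / M%:R) (n%:R / M%:R) (k %/ M)%:R m m0 d0 d1.
have -> : (k %/ M)%:R + m%:R + 3 = ((k %/ M).+1 + m + 2)%:R :> R.
  by rewrite !natrD -natr1; ring.
move=> /(_ _ _ _ _) H; apply: (@le_trans _ _ (M%:R * (2 ^- (m + 2) + 2 ^- (m + 2)))).
  rewrite ler_pM2l // lerD //; last first.
    by rewrite -addnA exprD invfM mulrA divff ?mul1r // expf_neq0.
  apply: H.
  - apply: (@le_trans _ _ (delta ^+ 2 * (C.+1 * m)%:R)).
      by rewrite natrM mulrA ler_wpM2r.
    apply: ler_wpM2l; first by rewrite exprn_ge0 // ltW.
    apply: le_trans (div_le n).
    by rewrite ler_nat layers_ge.
  - apply: le_trans (lerD (div_le k) (lexx _)) _.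
    by rewrite mulrA -mulrDl ler_pM2r ?invr_gt0.
  - by rewrite ler_pM2r ?invr_gt0 // ler_nat.
  - by rewrite divr_ge0 // ltW.
have -> : M%:R = 2 ^+ m :> R by rewrite /M widthE natrX.
rewrite exprD; have : 2 ^+ m != 0 :> R by rewrite expf_neq0.
by move: (2 ^+ m) => q q0; rewrite le_eqVlt; apply/orP; left; apply/eqP; field.
Qed.

End Numeric.

(** * Expected running time *)

Section Coins.

Context {R : realType}.
Local Open Scope ring_scope.

Section Miss.

Variable good : tree -> Prop.

Definition succeeded (g : config) : bool := halted g && `[< good (output g) >].

(** Halted configurations are stable, so this probability decreases with [L]; it controls both the
    running time and the correctness of the output. *)
Definition miss (L : nat) (g : config) : R :=
  avg L (fun w => (~~ succeeded (run_from g w))%:R).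

Lemma miss_ge0 L g : 0 <= miss L g.
Proof. by apply: avg_ge0 => w; rewrite ler0n. Qed.

Lemma miss_le1 L g : miss L g <= 1.
Proof.
rewrite -[leRHS](avg_const L 1); apply: ler_avg => w _.
by case: succeeded; rewrite ?ler01 ?lexx.
Qed.

Lemma miss_succeeded L g : succeeded g -> miss L g = 0.
Proof.
move=> Hg; rewrite -[RHS](avg_const L 0); apply: eq_avg => w _.
by rewrite run_from_halted ?Hg //; case/andP: Hg.
Qed.

Lemma miss_add L1 L2 g :
  miss (L1 + L2) g = avg L1 (fun w => miss L2 (run_from g w)).
Proof.
rewrite /miss avg_add; apply: eq_avg => w1 _; apply: eq_avg => w2 _.
by rewrite run_from_cat.
Qed.

Lemma miss_antitone L1 L2 g : (L1 <= L2)%N -> miss L2 g <= miss L1 g.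
Proof.
move=> L12; rewrite -(subnKC L12) miss_add; apply: ler_avg => w _.
case Hw: (succeeded (run_from g w)); first by rewrite miss_succeeded.
exact: miss_le1.
Qed.

Lemma miss_step L g : miss L.+1 g = (miss L (step false g) + miss L (step true g)) / 2.
Proof. by []. Qed.

Lemma miss_det L g g' : (forall b, step b g = g') -> miss L.+1 g = miss L g'.
Proof. by move=> H; rewrite miss_step !H; field. Qed.

Lemma miss_exec L c k s t s' : exec c s t s' -> miss (t + L) (c :: k, s) = miss L (k, s').
Proof.
move=> Hc; rewrite miss_add -[RHS](avg_const t); apply: eq_avg => w wt.
by rewrite (exec_run Hc).
Qed.

(** A run that halts with a bad output keeps it forever and has probability [2 ^- size w], so [miss]
    could never fall below that value; [j = size w + 1] gives the contradiction. Hence all halting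
    runs are good, not just almost all. *)
Lemma halted_good (T : nat -> nat) g w :
  (forall j, (j <= T j)%N) -> (forall j, miss (T j) g <= 2 ^- j) ->
  halted (run_from g w) -> good (output (run_from g w)).
Proof.
move=> HT Hg Hw; apply: contrapT => bad.
have fw : succeeded (run_from g w) = false.
  by rewrite /succeeded Hw /=; apply/negbTE/asboolP.
pose j := (size w).+1; have jw : (size w <= T j)%N by apply: leq_trans (HT j).
have := Hg j; rewrite -(subnKC jw) miss_add; set D := (_ - _)%N => Hj.
have := avg_ge (F := fun w => miss D (run_from g w)) w (fun _ => miss_ge0 _ _).
rewrite {1}/miss (eq_avg (G := fun=> 1)) => [|w2 _]; last by rewrite run_from_halted // fw.
rewrite avg_const => H; have : 1 <= 2 ^+ size w * 2 ^- j :> R.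
  by apply: le_trans H _; rewrite ler_wpM2l ?exprn_ge0.
rewrite /j exprS invfM mulrCA divff ?expf_neq0 // mulr1.
by rewrite leNgt invf_lt1 // ltr1n.
Qed.

End Miss.

Definition alive (L : nat) (g : config) : R :=
  avg L (fun w => (~~ halted (run_from g w))%:R).

Lemma aliveE L g : alive L g = miss (fun=> True) L g.
Proof.
by apply: eq_avg => w _; rewrite /succeeded asboolT // andbT.
Qed.

Lemma alive_le_miss good L g : alive L g <= miss good L g.
Proof.
apply: ler_avg => w _; rewrite ler_nat /succeeded.
by case: (halted _).
Qed.

Lemma card_avg t (P : seq bool -> bool) :
  #|[set w : t.-tuple bool | P w]|%:R / 2 ^+ t = avg t (fun w => (P w)%:R) :> R.
Proof.
have -> : #|[set w : t.-tuple bool | P w]|%:R = \sum_(w : t.-tuple bool) (P w)%:R :> R.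
  rewrite -sum1_card natr_sum big_mkcond; apply: eq_bigr => w _.
  by rewrite inE; case: (P w).
elim: t P => [|t IH] P.
  rewrite expr0 divr1 (bigD1 [tuple]) //= big1 ?addr0 // => w /eqP; case.
  by rewrite tuple0.
rewrite /= -!IH; have -> : \sum_(w : t.+1.-tuple bool) (P w)%:R =
    \sum_(w : t.-tuple bool) (P (false :: w))%:R +
    \sum_(w : t.-tuple bool) (P (true :: w))%:R :> R.
  rewrite (reindex (fun z : bool * t.-tuple bool => cons_tuple z.1 z.2)) /=.
    rewrite -(pair_bigA _ (fun b (w : t.-tuple bool) => (P (b :: w))%:R)) /=.
    by rewrite big_bool /= addrC.
  exists (fun w : t.+1.-tuple bool => (thead w, behead_tuple w)) => [[b w] _|w _] /=.
    by congr pair; apply: val_inj.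
  by rewrite [w in RHS]tuple_eta.
by rewrite exprS; field; rewrite expf_neq0.
Qed.

Lemma halts_exactly_rcons c inp w b :
  halts_exactly c inp (rcons w b) =
    halted (run c inp (rcons w b)) && ~~ halted (run c inp w).
Proof.
rewrite /halts_exactly; case: (halted _) => //=.
apply/forallP/idP => [H|H i].
  have lt_w : (size w < size (rcons w b))%N by rewrite size_rcons.
  by have := H (Ordinal lt_w); rewrite /= -cats1 take_size_cat.
have iw : (i <= size w)%N by rewrite -ltnS -(size_rcons w b) ltn_ord.
have -> : take i (rcons w b) = take i w.
  by move: (nat_of_ord i) iw => k kw; rewrite -cats1 takel_cat.
apply: contra H => Hi; rewrite -[w](cat_take_drop i) -[run _ _ _]/(run_from (init c inp) _).
by rewrite run_from_cat run_from_halted.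
Qed.

Lemma time_prob0 c inp : time_prob R c inp 0 = 0.
Proof.
rewrite /time_prob (card_avg 0 (halts_exactly c inp)) /=.
by rewrite /halts_exactly.
Qed.

Lemma time_probS c inp t :
  time_prob R c inp t.+1 = alive t (init c inp) - alive t.+1 (init c inp).
Proof.
have split1 (F : seq bool -> R) : avg t.+1 F = avg t (fun w => avg 1 (fun u => F (w ++ u))).
  by rewrite -addn1 avg_add.
rewrite /time_prob (card_avg t.+1 (halts_exactly c inp)) /alive !split1 -avgB.
apply: eq_avg => w _ /=; rewrite !cats1 !halts_exactly_rcons.
have : forall b, halted (run c inp w) -> halted (run c inp (rcons w b)).
  move=> b Hw; rewrite -cats1 -[run _ _ _]/(run_from (init c inp) _).
  by rewrite run_from_cat run_from_halted.
rewrite /run -!/(run_from (init c inp) _).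
case: (halted (run_from (init c inp) w)) => H; last first.
  by do 2 case: (halted _) => /=; field.
by rewrite !H //=; field.
Qed.

Lemma sum_time_prob c inp N :
  \sum_(0 <= t < N.+1) time_prob R c inp t = 1 - alive N (init c inp).
Proof.
elim: N => [|N IH]; first by rewrite big_nat1 time_prob0 /alive /= subrr.
by rewrite big_nat_recr //= IH time_probS; ring.
Qed.

(** Summation by parts: the tail formula for an expectation, truncated at [N], with its boundary
    term. *)
Lemma sum_time c inp N :
  \sum_(0 <= t < N.+1) t%:R * time_prob R c inp t =
  \sum_(0 <= i < N) alive i (init c inp) - N%:R * alive N (init c inp).
Proof.
elim: N => [|N IH]; first by rewrite big_nat1 big_geq // !mul0r subr0.
by rewrite big_nat_recr //= IH time_probS [in RHS]big_nat_recr //= -!natr1; ring.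
Qed.

Lemma time_prob_ge0 c inp t : 0 <= time_prob R c inp t.
Proof. by rewrite /time_prob divr_ge0 ?exprn_ge0 // ler0n. Qed.

Lemma alive_antitone L1 L2 g : (L1 <= L2)%N -> alive L2 g <= alive L1 g.
Proof. by rewrite !aliveE; apply: miss_antitone. Qed.

Lemma alive_le1 L g : alive L g <= 1.
Proof. by rewrite aliveE miss_le1. Qed.

Lemma alive_ge0 L g : 0 <= alive L g.
Proof. by rewrite aliveE miss_ge0. Qed.

(** The first [t0] terms are at most 1 each, and those of the [j]-th block of length [tau] at most
    [2 ^- j] each; the geometric series sums to 2. *)
Lemma sum_alive t0 tau g N : (0 < tau)%N ->
  (forall j, alive (t0 + j * tau) g <= 2 ^- j) ->
  \sum_(0 <= i < N) alive i g <= (t0 + 2 * tau)%:R.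
Proof.
move=> tau0 H.
have block j : \sum_(0 <= i < t0 + j * tau) alive i g <= t0%:R + tau%:R * (2 - 2 * 2 ^- j).
  elim: j => [|j IH].
    rewrite mul0n addn0 expr0 invr1 mulr1 subrr mulr0 addr0.
    have -> : t0%:R = \sum_(0 <= i < t0) (1 : R) by rewrite sumr_const_nat subn0.
    by apply: ler_sum => i _; exact: alive_le1.
  rewrite (big_cat_nat (n := (t0 + j * tau)%N)) ?leq_add2l ?leq_mul2r ?leqnSn ?orbT //=.
  apply: (@le_trans _ _ (t0%:R + tau%:R * (2 - 2 * 2 ^- j) + tau%:R * 2 ^- j)); last first.
    rewrite exprS invfM -addrA lerD2l -mulrDr ler_pM2l ?ltr0n //.
    by rewrite le_eqVlt; apply/orP; left; apply/eqP; field; rewrite expf_neq0.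
  apply: lerD => //; have -> : tau%:R * 2 ^- j =
      \sum_(t0 + j * tau <= i < t0 + j.+1 * tau) (2 ^- j : R).
    by rewrite sumr_const_nat mulSn addnCA addnK mulr_natl.
  rewrite ler_sum_nat // => i /andP[ji _]; apply: le_trans (H j).
  exact: alive_antitone.
apply: (@le_trans _ _ (\sum_(0 <= i < t0 + N * tau) alive i g)).
  have NL : (N <= t0 + N * tau)%N by rewrite (leq_trans _ (leq_addl _ _)) // leq_pmulr.
  rewrite [leRHS](big_cat_nat (n := N)) //= lerDl sumr_ge0 // => i _.
  exact: alive_ge0.
apply: le_trans (block N) _; rewrite natrD natrM lerD2l mulrC ler_wpM2r //.
by rewrite gerBl mulr_ge0 // invr_ge0 exprn_ge0.
Qed.

Lemma pow2N_small (e : R) : 0 < e -> exists j, 2 ^- j <= e.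
Proof.
move=> e0; exists (Num.truncn e^-1).+1.
rewrite -[leRHS]invrK lef_pV2 ?posrE ?invr_gt0 ?exprn_gt0 //.
apply: (@le_trans _ _ (Num.truncn e^-1).+1%:R).
  by rewrite ltW // truncnS_gt.
by rewrite -natrX ler_nat ltnW // ltn_expl.
Qed.

Lemma expected_time_le_alive c inp t0 tau : (0 < tau)%N ->
  (forall j, alive (t0 + j * tau) (init c inp) <= 2 ^- j) ->
  expected_time_le c inp ((t0 + 2 * tau)%:R : R).
Proof.
move=> tau0 H; split.
  have partial N : (\sum_(0 <= t < N) (time_prob R c inp t)%:E <= 1%E)%E.
    rewrite sumEFin lee_fin; case: N => [|N]; first by rewrite big_geq.
    by rewrite sum_time_prob gerBl alive_ge0.
  have ge0 t : (0 <= (time_prob R c inp t)%:E)%E by rewrite lee_fin time_prob_ge0.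
  apply/eqP; rewrite eq_le; apply/andP; split.
    apply: lime_le; first by apply: is_cvg_nneseries => *; exact: ge0.
    by apply: nearW => N; exact: partial.
  apply/lee_addgt0Pr => e /pow2N_small [j je].
  apply: (@le_trans _ _
    ((\sum_(0 <= t < (t0 + j * tau).+1) (time_prob R c inp t)%:E) + e%:E)%E).
    rewrite sumEFin sum_time_prob -EFinD lee_fin.
    by have := H j; lra.
  rewrite leeD2r //; apply: nneseries_lim_ge => *; exact: ge0.
rewrite /expected_time; apply: lime_le.
  apply: is_cvg_nneseries => t _ _.
  by rewrite lee_fin mulr_ge0 // time_prob_ge0.
apply: nearW => N; rewrite sumEFin lee_fin; case: N => [|N].
  by rewrite big_geq.
rewrite sum_time; apply: le_trans (sum_alive N tau0 H).
by rewrite gerBl mulr_ge0 // alive_ge0.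
Qed.

End Coins.

(** * The randomized retry loop *)

Section Retry.

Local Open Scope nat_scope.

Definition flip_loop : cmd :=
  CWhile 3 (CSeq (CFlip 5) (CSeq (CNode 4 5 4) (CRight 3 3))).

(** [Some b] is encoded by a node and [None] by a leaf, so testing register 5 detects success;
    clearing register 2 then leaves the loop. *)
Definition try_cmd (cE : cmd) : cmd :=
  CSeq (CNode 5 0 4) (CSeq (shift_cmd 5 cE)
    (CIf 5 (CSeq (CLeft 0 5) (CLeaf 2)) (CLeaf 4))).

(** Registers: 0 holds the input and the final output, 1 the number of coins,
    2 is a node as long as no attempt succeeded, 4 holds the coins. *)
Definition retry_loop (cE : cmd) : cmd :=
  CWhile 2 (CSeq (CCopy 3 1) (CSeq (CLeaf 4) (CSeq flip_loop (try_cmd cE)))).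

Definition retry_prelude (u : tree) (cD : cmd) : cmd :=
  CSeq (const_cmd 1 u) (CSeq (CNode 0 1 0) (CSeq (CCopy 4 0)
    (CSeq (shift_cmd 4 cD) (CSeq (CCopy 1 4) (CNode 2 0 0))))).

Definition retry (u : tree) (cD cE : cmd) : cmd :=
  CSeq (retry_prelude u cD) (retry_loop cE).

Context {R : realType}.

(** The duration of the loop does not depend on the coins, hence an exact average. Each coin costs 6
    units, namely the loop test, two sequencings and three assignments; the last unit is the final
    test. *)
Lemma miss_flips good k d acc s :
  s 3 = encode d -> s 4 = encode acc ->
  exists S : seq bool -> store,
    [/\ forall r, size r = d -> S r 4 = encode (catrev r acc),
      forall r x, x < 3 -> S r x = s x &
      forall L, miss good (6 * d + 1 + L) (flip_loop :: k, s) =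
        avg d (fun r => miss good L (k, S r)) :> R].
Proof.
elim: d acc s => [|d IH] acc s s3 s4.
  exists (fun=> s); split=> // [[]|L] //.
  by rewrite (@miss_det _ _ _ _ (k, s)) //= => b; rewrite s3.
pose s1 b := set_var s 5 (tree_of_bit b).
pose s2 b := set_var (s1 b) 4 (Node (s1 b 5) (s1 b 4)).
pose s3' b := set_var (s2 b) 3 (right_tree (s2 b 3)).
have H b : exists S : seq bool -> store,
    [/\ forall r, size r = d -> S r 4 = encode (catrev r (b :: acc)),
      forall r x, x < 3 -> S r x = s x &
      forall L, miss good (6 * d + 1 + L) (flip_loop :: k, s3' b) =
        avg d (fun r => miss good L (k, S r)) :> R].
  have [||S [S4 Sx SL]] := IH (b :: acc) (s3' b).
  - by rewrite /s3' /s2 /s1 /set_var /= s3.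
  - by rewrite /s3' /s2 /s1 /set_var /= s4.
  exists S; split=> // r x x3; rewrite Sx // /s3' /s2 /s1 /set_var.
  by do 3 (case: eqP => [xE|_]; first by rewrite xE in x3).
have [Sf [Sf4 Sfx SfL]] := H false; have [St [St4 Stx StL]] := H true.
exists (fun r => if r is b :: r' then (if b then St r' else Sf r') else s); split.
- by move=> [//|[] r] [rd] /=; [rewrite St4 | rewrite Sf4].
- by move=> [//|[] r] x x3; [rewrite Stx | rewrite Sfx].
move=> L; rewrite [RHS]/= -SfL -StL.
have -> : 6 * d.+1 + 1 + L = 6 + (6 * d + 1 + L) by lia.
move: (6 * d + 1 + L) => K {H IH Sf Sf4 Sfx SfL St St4 Stx StL}.
rewrite (_ : 6 + K = (3 + K).+3) // (@miss_det _ _ _ _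
  ([:: CSeq (CFlip 5) (CSeq (CNode 4 5 4) (CRight 3 3)), flip_loop & k], s)); last first.
  by move=> b /=; rewrite s3.
rewrite (@miss_det _ _ _ _
  ([:: CFlip 5, CSeq (CNode 4 5 4) (CRight 3 3), flip_loop & k], s)) // miss_step.
have next b : miss good (3 + K) ([:: CSeq (CNode 4 5 4) (CRight 3 3), flip_loop & k], s1 b) =
    miss good K (flip_loop :: k, s3' b) :> R.
  apply: (miss_exec _ _ _ (t := 3)).
  by apply: (@ExecSeq _ _ _ 1 _ 1); constructor.
by rewrite -[step false _]/(_, s1 false) -[step true _]/(_, s1 true) !next.
Qed.

Section Attempts.

Context A B {eA : encoding A} {eB : encoding B}.
Variables (f : A * seq bool -> option B) (cE : cmd) (e : nat).
Hypothesis cE_call : forall o s z, s o = encode z ->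
  exists t s', [/\ exec (shift_cmd o cE) s t s', s' o = encode (f z),
    forall x, x < o -> s' x = s x, t <= wt z ^ e & wt (f z) <= wt z ^ e].

Variables (a : A) (d W : nat).
Hypothesis W_bound : forall r : seq bool, size r = d -> wt (a, rev r) <= W.

Definition ready (s : store) : Prop :=
  [/\ s 0 = encode a, s 1 = encode d & is_node (s 2)].

Definition attempt_output (u : tree) : Prop :=
  exists r b, [/\ size r = d, f (a, rev r) = Some b & u = encode b].

Lemma exec_try s r : ready s -> s 4 = encode (rev r) -> size r = d ->
  exists t s', [/\ exec (try_cmd cE) s t s', t <= W ^ e + 10 &
    if f (a, rev r) is Some b then s' 2 = Leaf /\ s' 0 = encode b else ready s'].
Proof.
move=> [s0 s1 s2] s4 rd; set u := set_var s 5 (Node (s 0) (s 4)).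
have u5 : u 5 = encode (a, rev r) by rewrite /u /set_var /= s0 s4.
have [t [v [xv rv kv lv _]]] := cE_call u5.
have tW : t <= W ^ e.
  by apply: leq_trans lv _; case: (e) => // e'; rewrite leq_exp2r // W_bound.
case E: (f (a, rev r)) rv => [b|] rv.
  set v1 := set_var v 0 (left_tree (v 5)).
  exists (1 + (t + 4).+1).+1, (set_var v1 2 Leaf); split; last by rewrite /v1 /set_var /= rv.
    apply: ExecSeq (ExecNode _ _ _ _) _; apply: ExecSeq xv _.
    apply: ExecIf; rewrite rv /=.
    by apply: (@ExecSeq _ _ _ 1 _ 1); constructor.
  lia.
exists (1 + (t + 2).+1).+1, (set_var v 4 Leaf); split.
- apply: ExecSeq (ExecNode _ _ _ _) _; apply: ExecSeq xv _.
  by apply: ExecIf; rewrite rv /=; constructor.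
- lia.
by rewrite /ready /set_var /= !kv.
Qed.

Hypothesis half : (avg d (fun r => (~~ isSome (f (a, rev r)))%:R) <= 2^-1 :> R)%R.

(** Six units precede the flips, [6 * d + 1] go to the flips, [W ^ e + 10] bound the attempt, and
    one is left for the loop test that ends a successful round. *)
Definition round_time : nat := 6 + (6 * d + 1 + (W ^ e + 11)).

Lemma miss_round L (v : R) s : (0 <= v)%R ->
  (forall s', ready s' -> miss attempt_output L ([:: retry_loop cE], s') <= v)%R ->
  ready s -> (miss attempt_output (round_time + L) ([:: retry_loop cE], s) <= v / 2)%R.
Proof.
move=> v0 IH [s0 s1 s2].
have -> : round_time + L = (6 * d + 1 + (W ^ e + 11 + L)).+4.+2 by rewrite /round_time; lia.
pose s3 := set_var s 3 (s 1); pose s4 := set_var s3 4 Leaf.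
rewrite (@miss_det _ _ _ _ ([:: CSeq (CCopy 3 1) (CSeq (CLeaf 4)
  (CSeq flip_loop (try_cmd cE))); retry_loop cE], s)); last by move=> b /=; rewrite s2.
rewrite (@miss_det _ _ _ _ ([:: CCopy 3 1; CSeq (CLeaf 4)
  (CSeq flip_loop (try_cmd cE)); retry_loop cE], s)) //.
rewrite (@miss_det _ _ _ _ ([:: CSeq (CLeaf 4)
  (CSeq flip_loop (try_cmd cE)); retry_loop cE], s3)) //.
rewrite (@miss_det _ _ _ _ ([:: CLeaf 4; CSeq flip_loop (try_cmd cE); retry_loop cE], s3)) //.
rewrite (@miss_det _ _ _ _ ([:: CSeq flip_loop (try_cmd cE); retry_loop cE], s4)) //.
rewrite (@miss_det _ _ _ _ ([:: flip_loop; try_cmd cE; retry_loop cE], s4)) //.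
have [||S [S4 Sx ->]] :=
  @miss_flips attempt_output [:: try_cmd cE; retry_loop cE] d [::] s4.
- by rewrite /s4 /s3 /set_var /= s1.
- by [].
apply: (@le_trans _ _ (avg d (fun r => v * (~~ isSome (f (a, rev r)))%:R)%R)); last first.
  by rewrite avgZ ler_wpM2l.
apply: ler_avg => r rd; have Sr : ready (S r) by rewrite /ready !Sx.
have [t [s' [xs' tW]]] := exec_try Sr (S4 r rd) rd.
have -> : W ^ e + 11 + L = t + (W ^ e + 10 - t + L).+1 by lia.
rewrite (miss_exec _ _ _ xs'); case Ef: (f (a, rev r)) => [b|] => [[s'2 s'0]|rs'].
  rewrite mulr0 (@miss_det _ _ _ _ ([::], s')) => [|b']; last by rewrite /= s'2.
  rewrite miss_succeeded // /succeeded /=; apply/asboolP.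
  by exists r, b; split=> //.
(* A failed attempt may finish early; the loop is then ready again with at least [L] units left, and
   extra time can only lower [miss]. *)
rewrite mulr1; apply: le_trans (IH _ rs'); apply: miss_antitone.
by rewrite -addSn leq_addl.
Qed.

Lemma miss_rounds j s : ready s ->
  (miss attempt_output (j * round_time) ([:: retry_loop cE], s) <= 2 ^- j :> R)%R.
Proof.
elim: j s => [|j IH] s rs; first by rewrite expr0 invr1 miss_le1.
by rewrite mulSn exprS invfM mulrC; apply: miss_round => //.
Qed.

End Attempts.

(** The prelude attaches the constant [u], later the encoding of [C], to the input and computes the
    number of coins once; [t0] covers this cost before the rounds start. *)
Lemma retry_correct A B {eA : encoding A} {eB : encoding B}
    (f : A * seq bool -> option B) (g : A -> nat) cD cE eD eE u tu (inp : tree) a W :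
  (forall o s z, s o = encode z ->
    exists t s', [/\ exec (shift_cmd o cE) s t s', s' o = encode (f z),
      forall x, x < o -> s' x = s x, t <= wt z ^ eE & wt (f z) <= wt z ^ eE]) ->
  (forall o s z, s o = encode z ->
    exists t s', [/\ exec (shift_cmd o cD) s t s', s' o = encode (g z),
      forall x, x < o -> s' x = s x, t <= wt z ^ eD & wt (g z) <= wt z ^ eD]) ->
  (forall o s, exists s', [/\ exec (const_cmd o u) s tu s', s' o = u &
      forall x, x < o -> s' x = s x]) ->
  Node u inp = encode a ->
  (forall r : seq bool, size r = g a -> wt (a, rev r) <= W) ->
  (avg (g a) (fun r => (~~ isSome (f (a, rev r)))%:R) <= 2^-1 :> R)%R ->
  exists t0, t0 <= tu + wt a ^ eD + 20 /\
    forall j, (miss (attempt_output f a (g a)) (t0 + j * round_time eE (g a) W)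
      (init (retry u cD cE) inp) <= 2 ^- j :> R)%R.
Proof.
move=> callE callD constu Ea W_bound half.
set s := set_var (fun=> Leaf) 0 inp.
have [s1 [x1 r1 k1]] := constu 1 s.
set s2 := set_var s1 0 (Node (s1 1) (s1 0)); set s3 := set_var s2 4 (s2 0).
have s34 : s3 4 = encode a by rewrite /s3 /s2 /set_var /= r1 k1 // -Ea.
have [t [s4 [x4 r4 k4 t4 _]]] := callD 4 s3 a s34.
set s5 := set_var s4 1 (s4 4); set s6 := set_var s5 2 (Node (s5 0) (s5 0)).
pose tp := (tu + (1 + (1 + (t + (1 + 1).+1).+1).+1).+1).+1.
have x6 : exec (retry_prelude u cD) s tp s6.
  apply: ExecSeq x1 _; apply: ExecSeq (ExecNode _ _ _ _) _.
  apply: ExecSeq (ExecCopy _ _ _) _; apply: ExecSeq x4 _.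
  by apply: ExecSeq (ExecCopy _ _ _) _; constructor.
exists tp.+1; split; first by rewrite /tp; lia.
move=> j; rewrite addSn (@miss_det _ _ _ _ ([:: retry_prelude u cD; retry_loop cE], s)) //.
rewrite (miss_exec _ _ _ x6); apply: miss_rounds => //.
by rewrite /ready /s6 /s5 /set_var /= k4 // r4 /s3 /s2 /set_var /= r1 k1 // -Ea.
Qed.

End Retry.

(** Choosing the least halting time gives what [halts_exactly] asks for without examining the
    intermediate stacks. *)
Lemma halts_within c inp t s' :
  exec c (set_var (fun=> Leaf) 0%N inp) t s' ->
  exists t', [/\ (t' <= t)%N, halts_exactly c inp (nseq t' false) &
    output (run c inp (nseq t' false)) = s' 0%N].
Proof.
move=> xc; have Rt : run_from (init c inp) (nseq t false) = ([::], s').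
  by rewrite (exec_run xc) // size_nseq.
have exP : exists k, halted (run_from (init c inp) (nseq k false)).
  by exists t; rewrite Rt.
case: (ex_minnP exP) => t' Ht' min_t'; exists t'.
have tt' : (t' <= t)%N by apply: min_t'; rewrite Rt.
split=> //.
  apply/andP; split=> //; apply/forallP => i.
  have it' : (i < t')%N by rewrite -[X in (_ < X)%N](size_nseq t' false).
  move: (nat_of_ord i) it' => k kt'; rewrite take_nseq ?(ltnW kt') //.
  by apply: contraL kt' => /min_t'; rewrite -leqNgt.
rewrite -[run _ _ _]/(run_from _ _) -(run_from_halted (nseq (t - t') false) Ht').
by rewrite -run_from_cat -nseqD subnKC // Rt.
Qed.

Definition dec_cmd (u : tree) (c : cmd) : cmd :=
  CSeq (const_cmd 1 u) (CSeq (CNode 0 1 0) c).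

Section Defects.

Local Open Scope nat_scope.

Variables (n : nat) (S : {set 'I_n}) (a : 'I_n -> bool).

Definition defect_list : seq (option bool) := [seq cell_state S a i | i <- enum 'I_n].

Lemma size_defect_list : size defect_list = n.
Proof. by rewrite size_map size_enum_ord. Qed.

Lemma nth_defect_list (i : 'I_n) : nth None defect_list i = cell_state S a i.
Proof. by rewrite (nth_map i) ?size_enum_ord // nth_ord_enum. Qed.

Lemma count_free_defects : count (free_cell defect_list) (iota 0 n) = n - #|S|.
Proof.
rewrite -val_enum_ord count_map (eq_count (a2 := [pred i | i \notin S])) => [|i /=].
  have -> : n - #|S| = #|~: S| by have := cardsC S; rewrite card_ord; lia.
  rewrite -sum1_count big_enum_cond -sum1_card; apply: eq_bigl => i.
  by rewrite !inE.
by rewrite /free_cell nth_defect_list /cell_state; case: (i \in S).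
Qed.

Lemma wt_defect_list : wt defect_list <= 3 + 9 * n.
Proof.
rewrite -[in X in _ <= X]size_defect_list; apply: wt_seq_le.
rewrite all_map; apply/allP => i _ /=; rewrite /cell_state.
by case: (i \in S) => //; case: (a i).
Qed.

End Defects.

(** The left side is the bound of [expected_time_le_alive] with [round_time] unfolded; [P] dominates
    the powers that come from the subroutines. *)
Lemma time_budget (n P e1 e2 d tu t0 : nat) :
  (100 <= n)%N -> (tu <= n)%N -> (0 < P)%N -> (e1 <= P)%N -> (e2 <= P)%N ->
  (d <= n.+1 * (n + n.+1))%N -> (t0 <= tu + e2 + 20)%N ->
  (t0 + 2 * (6 + (6 * d + 1 + (e1 + 11))) <= P * (100 * n * n))%N.
Proof.
move=> n100 tun P0 e1P e2P dn t0_le.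
have nn : (100 * n <= n * n)%N by rewrite leq_mul2r n100 orbT.
have d_le : (d <= 2 * (n * n) + 3 * n + 1)%N by apply: leq_trans dn _; nia.
have T_le : (t0 + 2 * (6 + (6 * d + 1 + (e1 + 11))) <= 3 * P + 97 * (n * n))%N by lia.
apply: leq_trans T_le _; rewrite -mulnA mulnCA.
have : (n * n <= P * (n * n))%N by rewrite leq_pmull.
have : (P <= P * (n * n))%N by rewrite leq_pmulr // muln_gt0 andbb; lia.
lia.
Qed.

(** * Choice of the constants and the final bounds *)

Local Open Scope ring_scope.

Theorem theorem6p1 (R : realType) :
  exists Q : {poly {poly R}},
  forall (p delta : R), 0 <= p -> 0 < delta -> p + delta < 1 ->
  exists (enc dec : cmd) (d : nat -> nat) (C : R) (N : nat),
  forall n : nat, (N <= n)%N ->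
    (d n)%:R <= C * ln (n%:R) ^+ 3 /\
    encoding_scheme n (Num.truncn (p * n%:R))
      (Num.truncn ((1 - p - delta) * n%:R)) (d n) enc dec Q.[n%:R, delta^-1].
Proof.
have [cE [eE [_ callE]]] := polytime_call polytime_encode_attempt.
have [cD [eD [_ callD]]] := polytime_call polytime_seed_length_input.
have [cX [eX [detX callX]]] := polytime_decode_input.
(* The subroutines get inputs of weight at most [n ^ 3], since the seed length is at most quadratic
   in [n]; this explains the factor 3. The additional [n ^ 4] absorbs the remaining terms.
   Everything here is fixed before [p] and [delta]. *)
pose E := (3 * (eE + eD + eX) + 4)%N.
(* [delta] enters the times through [C] and [tu], which the threshold keeps below [n], so a power of
   [n] dominates. *)
exists ('X ^+ E) => p delta p0 d0 pd1.
(* Then [C.+1] exceeds [60 / delta ^+ 2], as [failure_le_half] requires. *)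
pose C := Num.truncn (60 / delta ^+ 2).
have [tu constu] := exec_const (encode C).
exists (retry (encode C) cD cE), (dec_cmd (encode C) cX), (seed_length C).
(* The threshold dominates the loading time [tu], makes [log_width C n] positive, and ensures
   [100 * n * n <= n ^ 3]. *)
exists ((64 * C.+1 * (2 * C.+1 + 1))%:R), (tu + 2 * C.+1 + 100)%N => n Nn.
have Cn : (2 * C.+1 <= n)%N by lia.
split; first exact: seed_length_polylog.
set s := Num.truncn (p * n%:R); set k := Num.truncn _; set d := seed_length C n.
have n_gt0 : (0 < n)%N by lia.
have nR : 0 <= n%:R :> R by [].
have kR : k%:R <= (1 - p - delta) * n%:R by rewrite truncn_le // mulr_ge0 //; lra.
have sR : s%:R <= p * n%:R by rewrite truncn_le // mulr_ge0.
have kn : (k <= n)%N.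
  rewrite -(ler_nat R); apply: le_trans kR _; rewrite ler_piMl //; lra.
have dn : (d <= n.+1 * (n + n.+1))%N by exact: seed_length_le.
have QE : ('X ^+ E : {poly {poly R}}).[n%:R, delta^-1] = (n ^ E)%:R.
  by rewrite hornerXn -rmorphXn /= hornerC natrX.
rewrite QE; pose Dec (x : n.-tuple bool) (r : d.-tuple bool) : k.-tuple bool :=
  Tuple (introT eqP (size_decode C r x k)).
have pow_le c e : (c <= n ^ 3 -> e <= eE + eD + eX -> c ^ e <= n ^ (3 * (eE + eD + eX)))%N.
  move=> cn ee; apply: (@leq_trans ((n ^ 3) ^ e)).
    by case: e {ee} => // e; rewrite leq_exp2r.
  by rewrite -expnM leq_exp2l ?leq_mul2l //; lia.
have nE (T : nat) : (T <= n ^ (3 * (eE + eD + eX)) * n ^ 4 -> T <= n ^ E)%N.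
  by rewrite -expnD.
set P := (n ^ (3 * (eE + eD + eX)))%N in pow_le nE.
have P0 : (0 < P)%N by rewrite expn_gt0 n_gt0.
have n100 : (100 <= n)%N by apply: leq_trans Nn; exact: leq_addl.
have n3 : (100 * n * n <= n ^ 3)%N by rewrite !expnS expn0 muln1 mulnA !leq_mul2r n100 !orbT.
exists Dec; split.
- by rewrite /= const_cmd_deterministic detX.
- move=> x r; set inp := decoder_input k x r.
  set s0 := set_var (fun=> Leaf) 0%N inp.
  have [s1 [x1 r1 k1]] := constu 1%N s0.
  set s2 := set_var s1 0%N (Node (s1 1%N) (s1 0%N)).
  have s20 : s2 0%N = encode (C, ((tval x, tval r), k)).
    by rewrite /s2 /set_var /= r1 k1.
  have [t [s3 [x3 r3 l3 _]]] := callX s2 _ s20.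
  have [t' [t't Ht' Ot']] : exists t', [/\ (t' <= (tu + (1 + t).+1).+1)%N,
      halts_exactly (dec_cmd (encode C) cX) inp (nseq t' false) &
      output (run (dec_cmd (encode C) cX) inp (nseq t' false)) = s3 0%N].
    apply: halts_within; apply: ExecSeq x1 _.
    by apply: ExecSeq (ExecNode _ _ _ _) x3.
  exists t'; split=> //; last by rewrite Ot' r3.
  rewrite ler_nat; apply: nE.
  have tP : (t <= P)%N.
    apply: leq_trans l3 _; apply: pow_le; last by lia.
    rewrite !wt_pair !wt_nat /=.
    have := wt_bits_le x; have := wt_bits_le r; rewrite !size_tuple => wr wx.
    apply: leq_trans n3; move: wr wx dn Nn kn; clear; nia.
  apply: leq_trans t't _; rewrite -/P.
  have : (P * n <= P * n ^ 4)%N by rewrite leq_mul2l expnS leq_pmulr ?orbT // expn_gt0 n_gt0.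
  move: tP P0 Nn; clear; nia.
move=> S a y Ss; set defs := defect_list S a; pose A := (C, (defs, tval y)).
have defs_n : size defs = n by exact: size_defect_list.
have EA : Node (encode C) (encoder_input S a y) = encode A by [].
have wA : (wt A <= 9 + 6 * C + 15 * n)%N.
  rewrite !wt_pair /= wt_nat; have := wt_defect_list S a; have := wt_bits_le y.
  by rewrite size_tuple -/defs => wy wd; move: wy wd Nn kn; clear; lia.
pose g (z : nat * (seq (option bool) * seq bool)) := seed_length z.1 (size z.2.1).
have gA : g A = d by rewrite /g /= defs_n.
have W_bound (r : seq bool) : size r = g A -> (wt (A, rev r) <= n ^ 3)%N.
  rewrite gA => rd; rewrite wt_pair; have := wt_bits_le (rev r); rewrite size_rev rd /= => wr.
  apply: leq_trans n3; move: wr wA dn Nn; clear; nia.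
have half : avg (g A) (fun r => (~~ isSome (encode_attempt (A, rev r)))%:R) <= 2^-1 :> R.
  have H := @failure_le_half R delta C defs (tval y) d0.
  rewrite (eq_avg (G := fun r => (~~ (attempt C defs (tval y) r).1)%:R)) => [|r _].
    apply: H; rewrite ?defs_n //; first lra.
      rewrite -ler_pdivrMl ?exprn_gt0 // mulrC ltW // truncnS_gt //.
    rewrite size_tuple count_free_defects Ss natrB; last first.
      rewrite -(ler_nat R); apply: le_trans sR _; rewrite ler_piMl //; lra.
    by lra.
  by rewrite /encode_attempt /= revK; case: ifP.
have [t0 [t0_le missT]] := @retry_correct R _ _ _ _ encode_attempt g cD cE eD eE
  (encode C) tu (encoder_input S a y) A (n ^ 3)%N callE callD constu EA W_bound half.
move: missT; rewrite gA; set tau := round_time _ _ _ => missT.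
have tau0 : (0 < tau)%N by rewrite /tau /round_time addSn.
split.
  have [hp T_le] : expected_time_le (retry (encode C) cD cE) (encoder_input S a y)
      ((t0 + 2 * tau)%:R : R).
    apply: expected_time_le_alive => // j; apply: le_trans (missT j).
    exact: alive_le_miss.
  split=> //; apply: le_trans T_le _; rewrite lee_fin ler_nat; apply: nE.
  have tauP : ((n ^ 3) ^ eE <= P)%N by apply: pow_le => //; rewrite -addnA leq_addr.
  have t0P : (wt A ^ eD <= P)%N.
    apply: pow_le; last by rewrite addnAC leq_addl.
    by apply: leq_trans n3; move: wA Nn; clear; nia.
  have n34 : (n ^ 3 <= n ^ 4)%N by rewrite leq_exp2l // (leq_trans _ Nn) // addnC.
  apply: (@leq_trans (P * (100 * n * n))); last first.
    by rewrite leq_mul2l (leq_trans n3) ?orbT.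
  by apply: time_budget t0P dn t0_le => //; apply: leq_trans Nn; rewrite -addnA leq_addr.
move=> w /andP[Hw _].
have [|r [[x' r'] [rd Hr ->]]] := halted_good (T := fun j => (t0 + j * tau)%N) _ missT Hw.
  by move=> j; rewrite (leq_trans _ (leq_addl _ _)) // leq_pmulr.
move: Hr; rewrite /encode_attempt /= revK; case: ifP => // ok [Ex Er].
have [xn xa xy] := attempt_sound ok; rewrite Ex in xn xa xy.
rewrite defs_n in xn.
have xsz : size x' == n by rewrite xn.
have rsz : size r' == d by rewrite -Er rd.
exists (Tuple xsz), (Tuple rsz); split=> //.
  move=> i iS; rewrite (tnth_nth false) /=; apply: xa.
  by rewrite nth_defect_list /cell_state iS.
by apply: val_inj; rewrite /= -Er -xy size_tuple.
Qed.
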